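(* (Strong Compact-Fredholm Alternative.) For the algebra $\mathbb{I}_1$ the Strong Compact-Fredholm Alternative holds (for left and for right simple $\mathbb{I}_1$-modules); $\mathcal{C}_{\mathbb{I}_1}=F$ and $\mathcal{F}_{\mathbb{I}_1}=\mathbb{I}_1\setminus F$. Moreover: (1) Let $a\in\mathbb{I}_1$, let $M$ be a nonzero left $\mathbb{I}_1$-module of finite length and $a_M:M\to M$, $m\mapsto am$. Then (a) $\dim_K(\ker(a_M))<\infty$ iff $\dim_K(\mathrm{coker}(a_M))<\infty$ iff $a\notin F$; (b) if, in addition, $M$ is simple, then $\dim_K(\mathrm{im}(a_M))<\infty$ iff $a\in F$. (2) Let $a\in\mathbb{I}_1$, let $N$ be a nonzero right $\mathbb{I}_1$-module of finite length and $a_N:N\to N$, $n\mapsto na$. Then (a) $\dim_K(\ker(a_N))<\infty$ iff $\dim_K(\mathrm{coker}(a_N))<\infty$ iff $a\notin F$; (b) if, in addition, $N$ is simple, then $\dim_K(\mathrm{im}(a_N))<\infty$ iff $a\in F$.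
   Context: $K$ is a field of characteristic zero. $\mathbb{I}_1$ is the subalgebra of $\mathrm{End}_K(K[x])$ generated by (multiplication by) $x$, $\partial=\frac{d}{dx}$ and $\int: x^n\mapsto \frac{x^{n+1}}{n+1}$. Put $e_{ij}:=\int^i\partial^j-\int^{i+1}\partial^{j+1}$ ($i,j\ge0$) and $F:=\bigoplus_{i,j\ge0}Ke_{ij}$, an ideal of $\mathbb{I}_1$. A $K$-linear map is compact if its image is finite dimensional, and Fredholm if its kernel and cokernel are finite dimensional. Let $A$ be a $K$-algebra. The Compact-Fredholm Alternative holds for an $A$-module $M$ if for each $a\in A$ the linear map $a_M:M\to M$, given by the action of $a$, is either compact or Fredholm; it holds for the algebra $A$ if it holds for each simple $A$-module. The Strong Compact-Fredholm Alternative holds for $A$ if, in addition, for each $a\in A$ either the maps $a_M$ are compact for all simple $A$-modules $M$ (then $a$ is called a compact element) or, otherwise, they are all Fredholm (then $a$ is called a Fredholm element). $\mathcal{C}_A$ and $\mathcal{F}_A$ denote the sets of compact and Fredholm elements of $A$ respectively. *)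

(* Defs.v *)
From HB Require Import structures.
From mathcomp Require Import all_boot all_algebra.
From mathcomp Require Import boolp classical_sets.

Set Implicit Arguments.
Unset Strict Implicit.
Unset Printing Implicit Defensive.

Import GRing.Theory.

Local Open Scope ring_scope.
Local Open Scope classical_set_scope.

Section Dimension.
Variables (K : fieldType) (V : lmodType K).

Definition finite_dim (W : set V) : Prop :=
  exists n (v : 'I_n -> V),
    (forall i, W (v i)) /\
    forall w, W w -> exists c : 'I_n -> K, w = \sum_i c i *: v i.

(* V / W is finite dimensional: the cosets v i + W span it. *)
Definition finite_codim (W : set V) : Prop :=
  exists n (v : 'I_n -> V),
    forall u, exists c : 'I_n -> K, W (u - \sum_i c i *: v i).

End Dimension.

Section LinearMaps.
Variables (K : fieldType) (U V : lmodType K) (f : {linear U -> V}).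

Definition lin_ker : set U := f @^-1` [set 0].

Definition lin_im : set V := range f.

Definition compact_map : Prop := finite_dim lin_im.

Definition fredholm_map : Prop := finite_dim lin_ker /\ finite_codim lin_im.

End LinearMaps.

(* Submodules are boolean predicates; with the classical axioms of boolp every *)
(* subset of M is one.                                                         *)
Section Modules.
Variables (R : nzRingType) (M : lmodType R).

Definition nonzero_module : Prop := exists m : M, m != 0.

Definition simple_module : Prop :=
  nonzero_module /\
  forall S : {pred M}, submod_closed S -> S =i pred1 0 \/ S =i predT.

(* For submodules N and P: N is contained in P and P / N is simple, i.e. there *)
(* are exactly two submodules between N and P.                                 *)
Definition simple_factor (N P : {pred M}) : Prop :=
  [/\ {subset N <= P}, ~ {subset P <= N} &
      forall S : {pred M}, submod_closed S ->
        {subset N <= S} -> {subset S <= P} -> S =i N \/ S =i P].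

(* Existence of a composition series. *)
Definition finite_length : Prop :=
  exists (n : nat) (S : nat -> {pred M}),
    [/\ forall i, submod_closed (S i), S 0%N =i pred1 0, S n =i predT &
        forall i, (i < n)%N -> simple_factor (S i) (S i.+1)].

End Modules.

Section RestrictionOfScalars.
Variables (K : fieldType) (A : algType K).

Definition restr (M : lmodType A) : Type := M.

Variable M : lmodType A.

HB.instance Definition _ := GRing.Zmodule.on (restr M).

Let rscale (k : K) (m : restr M) : restr M := k%:A *: (m : M).

Let rscaleA k l m : rscale k (rscale l m) = rscale (k * l) m.
Proof. by rewrite /rscale scalerA -scalerAl mul1r scalerA. Qed.
Let rscale1 : left_id 1 rscale.
Proof. by move=> m; rewrite /rscale !scale1r. Qed.
Let rscaleDr : right_distributive rscale +%R.
Proof. by move=> k m n; rewrite /rscale scalerDr. Qed.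
Let rscaleDl m : {morph rscale^~ m : k l / k + l}.
Proof. by move=> k l; rewrite /rscale !scalerDl. Qed.

HB.instance Definition _ := GRing.Zmodule_isLmodule.Build K (restr M)
  rscaleA rscale1 rscaleDr rscaleDl.

Definition act (a : A) (m : restr M) : restr M := a *: (m : M).

Let act_is_linear a : linear (act a).
Proof.
move=> k m n; rewrite /act scalerDr; congr (_ + _).
by change (a *: (k%:A *: (m : M)) = k%:A *: (a *: (m : M)));
   rewrite !scalerA mulr_algl mulr_algr.
Qed.

HB.instance Definition _ a :=
  GRing.isLinear.Build K (restr M) (restr M) *:%R (act a) (act_is_linear a).

End RestrictionOfScalars.

Arguments act {K A} M a m.

(* A^c is the opposite algebra, so that right A-modules are lmodType A^c. *)
Section ConverseAlgebra.
Variables (K : fieldType) (A : algType K).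

HB.instance Definition _ := GRing.Lmodule.copy A^c A.

Let cscaleAl (k : K) (u v : A^c) :
  k *: (u * v : A^c) = (k *: u : A^c) * v :> A^c.
Proof. exact: (@scalerAr K A k v u). Qed.

HB.instance Definition _ := GRing.Lmodule_isLalgebra.Build K A^c cscaleAl.

Let cscaleAr (k : K) (u v : A^c) :
  k *: (u * v : A^c) = u * (k *: v : A^c) :> A^c.
Proof. exact: (@scalerAl K A k v u). Qed.

HB.instance Definition _ := GRing.Lalgebra_isAlgebra.Build K A^c cscaleAr.

End ConverseAlgebra.

(* For left modules; the versions for right modules are those of A^c. *)
Section Alternative.
Variables (K : fieldType) (A : algType K).

Definition cf_alternative_mod (M : lmodType A) : Prop :=
  forall a : A, compact_map (act M a) \/ fredholm_map (act M a).

Definition cf_alternative : Prop :=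
  forall M : lmodType A, simple_module M -> cf_alternative_mod M.

Definition compact_elements : set A :=
  [set a | forall M : lmodType A, simple_module M -> compact_map (act M a)].

(* "Otherwise" makes the two kinds of elements disjoint, also when every       *)
(* simple module is finite dimensional.                                        *)
Definition fredholm_elements : set A :=
  [set a | ~ compact_elements a /\
     forall M : lmodType A, simple_module M -> fredholm_map (act M a)].

Definition strong_cf_alternative : Prop :=
  cf_alternative /\
  forall a : A, compact_elements a \/ fredholm_elements a.

End Alternative.

Arguments cf_alternative {K} A.
Arguments compact_elements {K} A.
Arguments fredholm_elements {K} A.
Arguments strong_cf_alternative {K} A.

Section EndPoly.
Variable K : fieldType.

Definition endPoly : Type := {linear {poly K} -> {poly K}}.

HB.instance Definition _ := gen_eqMixin endPoly.
HB.instance Definition _ := gen_choiceMixin endPoly.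

Implicit Types f g h : endPoly.

Lemma endPolyP f g : f =1 g -> f = g.
Proof.
case: f g => f [[f0] [f1]] [g [[g0] [g1]]] /= /funext fg; subst g.
by congr (GRing.Linear.Pack (GRing.Linear.Class _ _)); congr (_ _);
   apply: Prop_irrelevance.
Qed.

Definition end_zero : endPoly := \0.
Definition end_opp f : endPoly := GRing.opp_fun f.
Definition end_add f g : endPoly := GRing.add_fun f g.
Definition end_scale (k : K) f : endPoly := k \*: f.
Definition end_one : endPoly := idfun.
Definition end_mul f g : endPoly := f \o g.

Let addA : associative end_add.
Proof. by move=> f g h; apply: endPolyP => p /=; rewrite addrA. Qed.
Let addC : commutative end_add.
Proof. by move=> f g; apply: endPolyP => p /=; rewrite addrC. Qed.
Let add0 : left_id end_zero end_add.
Proof. by move=> f; apply: endPolyP => p /=; rewrite add0r. Qed.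
Let addN : left_inverse end_zero end_opp end_add.
Proof. by move=> f; apply: endPolyP => p /=; rewrite addNr. Qed.

HB.instance Definition _ :=
  GRing.isZmodule.Build endPoly addA addC add0 addN.

Let mulA : associative end_mul.
Proof. by move=> f g h; apply: endPolyP. Qed.
Let mul1 : left_id end_one end_mul.
Proof. by move=> f; apply: endPolyP. Qed.
Let mulg1 : right_id end_one end_mul.
Proof. by move=> f; apply: endPolyP. Qed.
Let mulDl : left_distributive end_mul +%R.
Proof. by move=> f g h; apply: endPolyP. Qed.
Let mulDr : right_distributive end_mul +%R.
Proof. by move=> f g h; apply: endPolyP => p /=; rewrite raddfD. Qed.
Let one_neq0 : end_one != 0.
Proof.
apply/eqP => /(congr1 (fun f : endPoly => f 1)) /= /eqP.
by rewrite oner_eq0.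
Qed.

HB.instance Definition _ := GRing.Zmodule_isNzRing.Build endPoly
  mulA mul1 mulg1 mulDl mulDr one_neq0.

Let scaleA k l f : end_scale k (end_scale l f) = end_scale (k * l) f.
Proof. by apply: endPolyP => p /=; rewrite scalerA. Qed.
Let scale1 : left_id 1 end_scale.
Proof. by move=> f; apply: endPolyP => p /=; rewrite scale1r. Qed.
Let scaleDr : right_distributive end_scale +%R.
Proof. by move=> k f g; apply: endPolyP => p /=; rewrite scalerDr. Qed.
Let scaleDl f : {morph end_scale^~ f : k l / k + l}.
Proof. by move=> k l; apply: endPolyP => p /=; rewrite scalerDl. Qed.

HB.instance Definition _ := GRing.Zmodule_isLmodule.Build K endPoly
  scaleA scale1 scaleDr scaleDl.

Let scaleAl (k : K) (f g : endPoly) : k *: (f * g) = k *: f * g.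
Proof. exact: endPolyP. Qed.

HB.instance Definition _ :=
  GRing.Lmodule_isLalgebra.Build K endPoly scaleAl.

Let scaleAr (k : K) (f g : endPoly) : k *: (f * g) = f * (k *: g).
Proof. by apply: endPolyP => p; rewrite /= linearZ. Qed.

HB.instance Definition _ :=
  GRing.Lalgebra_isAlgebra.Build K endPoly scaleAr.

End EndPoly.

Section Generators.
Variable K : fieldType.

Definition mulX (p : {poly K}) : {poly K} := 'X * p.

Let mulX_is_linear : linear mulX.
Proof. by move=> k p q; rewrite /mulX mulrDr scalerAr. Qed.
HB.instance Definition _ :=
  GRing.isLinear.Build K {poly K} {poly K} *:%R mulX mulX_is_linear.

Definition integ (p : {poly K}) : {poly K} :=
  \poly_(i < size p) (p`_i / i.+1%:R) * 'X.

Lemma coef_integ p i :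
  (integ p)`_i = if i is j.+1 then p`_j / j.+1%:R else 0.
Proof.
rewrite coefMX; case: i => [|i] //=; rewrite coef_poly; case: ltnP => // le.
by rewrite nth_default ?mul0r.
Qed.

Lemma integXn n : integ 'X^n = n.+1%:R^-1 *: 'X^(n.+1).
Proof.
apply/polyP => i; rewrite coef_integ coefZ coefXn.
case: i => [|i]; first by rewrite mulr0.
by rewrite coefXn eqSS; case: eqP => [->|_]; rewrite ?mul1r ?mulr1 ?mul0r ?mulr0.
Qed.

Let integ_is_linear : linear integ.
Proof.
move=> k p q; apply/polyP => i; rewrite coefD coefZ !coef_integ.
by case: i => [|i]; rewrite ?mulr0 ?addr0 // coefD coefZ mulrDl mulrA.
Qed.
HB.instance Definition _ :=
  GRing.isLinear.Build K {poly K} {poly K} *:%R integ integ_is_linear.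

Definition end_x : endPoly K := mulX.
Definition end_d : endPoly K := @deriv K.
Definition end_int : endPoly K := integ.

(* The smallest subalgebra containing the three generators. *)
Definition inI1 : {pred endPoly K} := fun a =>
  `[< forall S : {pred endPoly K}, subalg_closed S ->
        end_x \in S -> end_d \in S -> end_int \in S -> a \in S >].

Lemma inI1_x : end_x \in inI1. Proof. exact/asboolP. Qed.
Lemma inI1_d : end_d \in inI1. Proof. exact/asboolP. Qed.
Lemma inI1_int : end_int \in inI1. Proof. exact/asboolP. Qed.

Let inI1_subalg : subalg_closed inI1.
Proof.
split=> [|k f g /asboolP fI /asboolP gI|f g /asboolP fI /asboolP gI];
  apply/asboolP => S SA Sx Sd Si; case: (SA) => S1 SL SM.
- exact: S1.
- by apply: SL; [exact: fI | exact: gI].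
- by apply: SM; [exact: fI | exact: gI].
Qed.
HB.instance Definition _ :=
  GRing.isSubalgClosed.Build K (endPoly K) inI1 inI1_subalg.

Definition I1 : Type := {a : endPoly K | a \in inI1}.

HB.instance Definition _ := SubChoice.on I1.
HB.instance Definition _ := [SubChoice_isSubAlgebra of I1 by <:].

Definition x1 : I1 := exist _ end_x inI1_x.
Definition d1 : I1 := exist _ end_d inI1_d.
Definition int1 : I1 := exist _ end_int inI1_int.

Definition e_ (i j : nat) : I1 :=
  int1 ^+ i * d1 ^+ j - int1 ^+ i.+1 * d1 ^+ j.+1.

Definition idealF : set I1 :=
  [set a | exists n (c : 'I_n -> 'I_n -> K),
     a = \sum_(i < n) \sum_(j < n) c i j *: e_ i j].

End Generators.

Arguments x1 : clear implicits.
Arguments d1 : clear implicits.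
Arguments int1 : clear implicits.
Arguments e_ : clear implicits.
Arguments idealF : clear implicits.

(* Main.v *)
Require Import Defs.
From HB Require Import structures.
From mathcomp Require Import all_boot all_algebra.
From mathcomp Require Import boolp classical_sets.
From mathcomp Require Import zify ring.

(** The algebra is generated by elements [x], [d], [s] (multiplication by the
    variable, derivation, integration), and the argument rests on the
    relations [d s = 1], [d x - x d = 1], [s d x = x] and [s d <> 1].
    Transposition of matrices in the basis [x^n / n!] exchanges [d] and [s]
    and carries these relations to the opposite algebra, and [F] to itself
    (integro_differential_converse, span_units_converse). So it suffices to
    treat left modules.

    Let [e = 1 - s d]. The ideal [F] is spanned by the [s^i e d^j]. On a
    simple module the kernel of [d], which is the image of [e], has dimension
    at most one (ker_d_simple), so the elements of [F] have finite rank.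
    Conversely an element killed on the left by a power of [d] lies in [F]
    (span_units_of_kill), and each element becomes an element of the Weyl
    algebra [K<x, d>] after multiplication by a power of [d] (normal_form).
    Hence, for [a] outside [F], the kernel of [a] on a module is contained in
    the kernel of a nonzero Weyl operator.

    Finiteness of that kernel on a simple module rests on two facts. First, a
    simple module has linear growth (simple_growth): each of its vectors is
    killed by a nonzero Weyl operator (weyl_annihilator), and the normally
    ordered monomials divisible by the leading one are redundant. Secondly, a
    simple module is torsion free over [K[x]] or over [K[d]]
    (simple_torsion_dichotomy), because in characteristic zero no nonzero
    vector is torsion over both (torsion_free_of_torsion). In the torsion free
    case the growth bounds the rank over the polynomial ring, and a Wronskian
    argument bounds the number of independent solutions (weyl_ker_finite).
    Once the kernel is finite-dimensional, comparing the dimensions of the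
    steps of the filtration shows that the cokernel is finite-dimensional too
    (codim_of_growth). So the elements outside [F] are Fredholm on simple
    modules (simple_fredholm).

    Both properties pass to modules of finite length through a composition
    series (ker_finite_length, coker_finite_length). They exclude one another
    on a nonzero module, which is infinite-dimensional (nonzero_infinite_dim),
    and a simple module exists (simple_module_exists); this turns the
    implications into equivalences. *)

Set Implicit Arguments.
Unset Strict Implicit.
Unset Printing Implicit Defensive.

Import GRing.Theory.

Local Open Scope ring_scope.
Local Open Scope classical_set_scope.

(** * Dimension and codimension of subspaces *)

Lemma underdetermined_system (K : fieldType) (I J : finType) (C : I -> J -> K) :
  (#|J| < #|I|)%N ->
  exists c : I -> K, (exists i, c i != 0) /\ forall j, \sum_i c i * C i j = 0.
Proof.
move=> ltJI.
pose B : 'M[K]_(#|I|, #|J|) := \matrix_(i, j) C (enum_val i) (enum_val j).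
have: kermx B != 0.
  rewrite kermx_eq0 /row_free neq_ltn.
  by rewrite (leq_ltn_trans (rank_leq_col B) ltJI).
case/rowV0Pn => v /sub_kermxP vB0 v0.
exists (fun i => v 0 (enum_rank i)); split.
  case/rV0Pn: v0 => i vi; exists (enum_val i); by rewrite enum_valK.
move=> j; have /rowP/(_ (enum_rank j)) := vB0.
rewrite !mxE => E; rewrite -[RHS]E.
rewrite (reindex (@enum_val I predT)) /=; last first.
  by apply: onW_bij; exact: enum_val_bij.
by apply: eq_bigr => i _; rewrite mxE enum_valK enum_rankK.
Qed.

Lemma big_ord_trunc (V : nmodType) n N (F : nat -> V) : (n <= N)%N ->
  (forall i, (n <= i)%N -> F i = 0) -> \sum_(i < N) F i = \sum_(i < n) F i.
Proof.
move=> nN F0; rewrite -(subnKC nN) big_split_ord /= [X in _ + X]big1 ?addr0 //.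
by move=> i _; rewrite F0 ?leq_addr.
Qed.

Section Subspaces.
Variables (K : fieldType).

Definition subspace (V : lmodType K) (W : set V) : Prop :=
  W 0 /\ forall (k : K) u v, W u -> W v -> W (k *: u + v).

(** With [W = 0] this bounds a dimension, with [U = setT] a codimension.
    Vectors outside [U] are allowed, so that the bound passes to any smaller
    [U] and any larger [W]. *)
Definition dimq_le (V : lmodType K) (W U : set V) (n : nat) : Prop :=
  exists v : nat -> V, forall u, U u ->
    exists c : nat -> K, W (u - \sum_(i < n) c i *: v i).

Definition indep_mod (V : lmodType K) (W : set V) n (v : nat -> V) : Prop :=
  forall c : nat -> K, W (\sum_(i < n) c i *: v i) -> forall i, (i < n)%N ->
    c i = 0.

Section OneSpace.
Variable V : lmodType K.
Implicit Types (W U : set V).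

Lemma subspace0 : subspace [set (0 : V)].
Proof. by split=> // k u v -> ->; rewrite scaler0 addr0. Qed.

Lemma subspaceT : subspace (@setT V).
Proof. by []. Qed.

Lemma subspaceI W U : subspace W -> subspace U -> subspace (W `&` U).
Proof.
case=> W0 Wl [U0 Ul]; split=> // k u v [Wu Uu] [Wv Uv].
by split; [apply: Wl | apply: Ul].
Qed.

Section Closure.
Variables (W : set V) (WS : subspace W).

Lemma subsp0 : W 0. Proof. by case: WS. Qed.

Lemma subspD u v : W u -> W v -> W (u + v).
Proof. by move=> Wu Wv; rewrite -[u]scale1r; apply: WS.2. Qed.

Lemma subspZ k u : W u -> W (k *: u).
Proof. by move=> Wu; rewrite -[_ *: _]addr0; apply: WS.2 => //; apply: subsp0.
  Qed.

Lemma subspN u : W u -> W (- u).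
Proof. by move=> Wu; rewrite -scaleN1r; apply: subspZ. Qed.

Lemma subspB u v : W u -> W v -> W (u - v).
Proof. by move=> Wu Wv; apply: subspD => //; apply: subspN. Qed.

Lemma subsp_sum (I : finType) (P : pred I) (F : I -> V) :
  (forall i, P i -> W (F i)) -> W (\sum_(i | P i) F i).
Proof. by move=> WF; elim/big_ind: _ => //; [apply: subsp0 | apply: subspD].
  Qed.

End Closure.

Lemma sum_concat m n (c c' : nat -> K) (v v' : nat -> V) :
  \sum_(i < m + n) (if (i < m)%N then c i else c' (i - m)%N) *:
      (if (i < m)%N then v i else v' (i - m)%N)
    = \sum_(i < m) c i *: v i + \sum_(i < n) c' i *: v' i.
Proof.
rewrite big_split_ord /=; congr (_ + _); apply: eq_bigr => i _.
  by rewrite ltn_ord.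
by rewrite ltnNge leq_addr /= addKn.
Qed.

Lemma dimq_le_trans W1 W2 U m n :
  dimq_le W2 U m -> dimq_le W1 W2 n -> dimq_le W1 U (m + n).
Proof.
case=> v vP [w wP];
  exists (fun i => if (i < m)%N then v i else w (i - m)%N) => u.
case/vP => c /wP [c' cP];
  exists (fun i => if (i < m)%N then c i else c' (i - m)%N).
by rewrite sum_concat opprD addrA.
Qed.

Lemma dimq_le0 W U : U `<=` W -> dimq_le W U 0.
Proof. by move=> UW; exists (fun=> 0) => u Uu; exists (fun=> 0);
  rewrite big_ord0 subr0; apply: UW. Qed.

Lemma dimq_le_mono W U m n : (m <= n)%N -> dimq_le W U m -> dimq_le W U n.
Proof.
move=> mn [v vU]; exists v => u /vU [c cP].
exists (fun i => if (i < m)%N then c i else 0).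
rewrite (big_ord_trunc (F := fun i => (if (i < m)%N then c i else 0) *:
  v i) mn) => [|i]; last by rewrite ltnNge => ->; rewrite scale0r.
by under eq_bigr => i _ do rewrite ltn_ord.
Qed.

Lemma dimq_leS W U W' U' n :
  W `<=` W' -> U' `<=` U -> dimq_le W U n -> dimq_le W' U' n.
Proof.
by move=> WW UU [v vP]; exists v => u /UU /vP [c /WW cP]; exists c.
Qed.

(** Steinitz exchange: more than [n] vectors of [U], expanded modulo [W] along
    [n] vectors, give an underdetermined system for a relation. *)
Lemma indep_le_dimq W U m n v : subspace W ->
  dimq_le W U n -> (forall i, (i < m)%N -> U (v i)) -> indep_mod W m v ->
    (m <= n)%N.
Proof.
move=> WS [y yP] vU vI; rewrite leqNgt; apply/negP => ltnm.
have /fin_all_exists [C CP] (i : 'I_m) := yP _ (vU i (ltn_ord i)).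
have [|c [[i ci] cC]] := @underdetermined_system K _ _
  (fun (i : 'I_m) (j : 'I_n) => C i j).
  by rewrite !card_ord.
pose c' k := if insub k is Some j then c j else 0.
have c'E (j : 'I_m) : c' j = c j by rewrite /c' valK.
suff : c' i = 0 by apply/eqP; rewrite c'E.
apply: vI (ltn_ord i).
suff -> : \sum_(j < m) c' j *: v j =
   \sum_(j < m) c j *: (v j - \sum_(k < n) C j k *: y k).
  by apply: subsp_sum => // j _; apply: subspZ.
under [RHS]eq_bigr => j _ do rewrite scalerBr scaler_sumr.
rewrite sumrB exchange_big /= [X in _ - X]big1 ?subr0.
  by apply: eq_bigr => j _; rewrite c'E.
move=> k _; under eq_bigr => j _ do rewrite scalerA.
by rewrite -scaler_suml cC scale0r.
Qed.

(** A family of maximal size among those independent modulo [W] spans. *)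
Lemma basis_mod W U N : subspace W ->
  (forall m v, (forall i, (i < m)%N -> U (v i)) -> indep_mod W m v ->
    (m <= N)%N) ->
  exists n v, [/\ (n <= N)%N, forall i, (i < n)%N -> U (v i), indep_mod W n v &
    forall u, U u -> exists c : nat -> K, W (u - \sum_(i < n) c i *: v i)].
Proof.
move=> WS bnd.
pose P m := `[< exists v, (forall i, (i < m)%N -> U (v i)) /\ indep_mod W m v
  >].
have exP : exists m, P m by exists 0%N; apply/asboolP; exists (fun=> 0);
  split=> // c _ [].
have bP m : P m -> (m <= N)%N by move/asboolP=> [v [vU /bnd]]; apply.
case: (ex_maxnP exP bP) => n /asboolP [v [vU vI]] nmax.
exists n, v; split=> //; first by apply: bnd vU vI.
move=> u Uu; pose v' i := if (i < n)%N then v i else u.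
have sumv' (c : nat -> K) :
    \sum_(i < n.+1) c i *: v' i = \sum_(i < n) c i *: v i + c n *: u.
  rewrite big_ord_recr /= /v' ltnn; congr (_ + _).
  by apply: eq_bigr => i _; rewrite ltn_ord.
have : ~ indep_mod W n.+1 v'.
  move=> I; suff /nmax : P n.+1 by rewrite ltnn.
  apply/asboolP; exists v'; split=> // i _; rewrite /v'; case: ifP => // /vU //.
case/existsNP => c /not_implyP [cW /existsNP [i /not_implyP [ltin /eqP ci]]].
rewrite sumv' in cW.
have cn : c n != 0.
  apply/negP => /eqP cn; rewrite cn scale0r addr0 in cW.
  move: ltin; rewrite ltnS leq_eqVlt => /orP [/eqP E|lt];
    first by rewrite E cn eqxx in ci.
  by rewrite (vI _ cW _ lt) eqxx in ci.
exists (fun i => - (c i / c n)).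
have -> : u - \sum_(i0 < n) - (c i0 / c n) *: v i0 =
   (c n)^-1 *: (\sum_(i < n) c i *: v i + c n *: u).
  rewrite scalerDr scalerA mulVf // scale1r addrC scaler_sumr; congr (_ + _).
  by rewrite -sumrN; apply: eq_bigr => j _; rewrite scaleNr opprK scalerA mulrC.
exact: subspZ.
Qed.

Lemma dimq_le_basis W U N : subspace W -> dimq_le W U N ->
  exists n v, [/\ (n <= N)%N, forall i, (i < n)%N -> U (v i), indep_mod W n v &
    forall u, U u -> exists c : nat -> K, W (u - \sum_(i < n) c i *: v i)].
Proof. by move=> WS dU; apply: basis_mod => // m v vU;
  apply: indep_le_dimq dU vU. Qed.

Lemma dimq_leP W U N : subspace W ->
  (forall v, (forall i, (i < N.+1)%N -> U (v i)) -> ~ indep_mod W N.+1 v) ->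
  dimq_le W U N.
Proof.
move=> WS H; have [|n [v [nN vU _ vS]]] := @basis_mod W U N WS; last first.
  by apply: dimq_le_mono nN _; exists v.
move=> m v vU vI; rewrite leqNgt; apply/negP => lt.
apply: (H v) => [i iN|c cW i iN]; first by apply: vU; apply: leq_trans lt.
have := vI (fun i => if (i < N.+1)%N then c i else 0) _ i (leq_trans iN lt).
rewrite iN; apply.
rewrite (big_ord_trunc (F := fun j => (if (j < N.+1)%N then c j else 0) *:
  v j) lt) => [|j]; last by move=> jN; rewrite ltnNge jN scale0r.
by under eq_bigr => j _ do rewrite ltn_ord.
Qed.

(** Spanning vectors modulo [W] can be chosen in [U], so that the remainders
    stay in [W `&` U]. *)
Lemma dimq_le_transI W1 W U m n : subspace W -> subspace U ->
  dimq_le W U m -> dimq_le W1 (W `&` U) n -> dimq_le W1 U (m + n).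
Proof.
move=> WS US /(dimq_le_basis WS) [r [v [rm vU _ vS]]] dI.
apply: (@dimq_le_trans _ (W `&` U)) => //; apply: dimq_le_mono rm _.
exists v => u Uu; have [c cW] := vS u Uu; exists c; split=> //.
apply: subspB => //; apply: subsp_sum => // i _; apply: subspZ => //; exact: vU.
Qed.

End OneSpace.

Section Linear.
Variables (V V' : lmodType K) (f : {linear V -> V'}).

Lemma linear_comb n (c : nat -> K) (v : nat -> V) :
  f (\sum_(i < n) c i *: v i) = \sum_(i < n) c i *: f (v i).
Proof. by rewrite linear_sum; apply: eq_bigr => i _; rewrite linearZ. Qed.

Lemma subspace_preimage W : subspace W -> subspace (f @^-1` W).
Proof.
by case=> W0 Wl; split=> [|k u v Wu Wv] /=; rewrite ?linear0 // linearP;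
  apply: Wl.
Qed.

Lemma subspace_image (U : set V) : subspace U -> subspace (f @` U).
Proof.
move=> US; split; first by exists 0; [apply: subsp0 | rewrite linear0].
move=> k _ _ [u Uu <-] [v Uv <-]; exists (k *: u + v); rewrite ?linearP //.
exact: US.2.
Qed.

Lemma dimq_le_preimage W0 W n : subspace W0 ->
  dimq_le W0 W n -> dimq_le (f @^-1` W0) (f @^-1` W) n.
Proof.
move=> WS dW; apply: dimq_leP; first exact: subspace_preimage.
move=> v vU vI; have := @indep_le_dimq _ W0 W n.+1 n (f \o v) WS dW vU.
rewrite ltnn => H; suff: false by []; apply: H => c cW; apply: vI.
by rewrite /= linear_comb.
Qed.

Lemma dimq_le_image W0 U0 U n : (forall u, U0 u -> W0 (f u)) ->
  dimq_le U0 U n -> dimq_le W0 (f @` U) n.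
Proof.
move=> fW [v vP]; exists (f \o v) => _ [u /vP [c cP] <-]; exists c.
by rewrite -linear_comb -linearB; apply: fW.
Qed.

End Linear.

Lemma finite_dimP (V : lmodType K) (W : set V) :
  finite_dim W <-> exists n, dimq_le [set 0] W n.
Proof.
split=> [[n [v [_ vP]]]|[n /(dimq_le_basis (subspace0 V)) [m [v [_ vW _ vP]]]]].
  exists n, (fun i => if insub i is Some j then v j else 0) => w /vP [c ->].
  exists (fun i => if insub i is Some j then c j else 0).
  by apply/eqP; rewrite subr_eq0; apply/eqP/eq_bigr => i _; rewrite !valK.
exists m, (fun i : 'I_m => v i); split=> [i|w /vP [c /eqP cP]]; first exact: vW.
by exists (fun i => c i); apply/eqP; rewrite -subr_eq0.
Qed.

Lemma finite_codimP (V : lmodType K) (W : set V) :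
  finite_codim W <-> exists n, dimq_le W setT n.
Proof.
split=> [[n [v vP]]|[n [v vP]]].
  exists n, (fun i => if insub i is Some j then v j else 0) => w _.
  case: (vP w) => c cW; exists (fun i => if insub i is Some j then c j else 0).
  by under eq_bigr => i _ do rewrite !valK.
exists n, (fun i : 'I_n => v i) => u; have [//|c cP] := vP u.
by exists (fun i => c i).
Qed.

(** The growth condition for Gelfand-Kirillov dimension at most one. *)
Definition linear_growth (V : lmodType K) (G : nat -> set V) (e : nat) : Prop :=
  [/\ forall k, subspace (G k), forall k l, (k <= l)%N -> G k `<=` G l,
      forall v, exists k, G k v & forall k, dimq_le [set 0] (G k) (e * k.+1)].

Lemma growth_common (V : lmodType K) (G : nat -> set V) e n (v : nat -> V) :
  linear_growth G e -> exists k, forall i, (i < n)%N -> G k (v i).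
Proof.
case=> _ Gm Ge _; elim: n => [|n [k IH]]; first by exists 0%N.
have [l Gl] := Ge (v n); exists (maxn k l) => i.
rewrite ltnS leq_eqVlt => /orP [/eqP ->|/IH].
  by apply: Gm Gl; rewrite leq_maxr.
by apply: Gm; rewrite leq_maxl.
Qed.

(** On a filtration of linear growth a finite kernel forces a finite cokernel.
    If [u] were [kappa + e * delta + 1] vectors independent modulo the image,
    then [f] maps [G k] to [G (k + delta)] losing at most [kappa] dimensions,
    and adding [u] shows that the dimension grows by more than [e * delta] at
    every step of length [delta]; this exceeds the linear bound. *)
Lemma codim_of_growth (V : lmodType K) (G : nat -> set V) e delta kappa
    (f : {linear V -> V}) : linear_growth G e ->
  (forall k v, G k v -> G (k + delta)%N (f v)) ->
  dimq_le [set 0] (lin_ker f) kappa ->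
  dimq_le (lin_im f) setT (kappa + e * delta).
Proof.
move=> gG fG dker; have [GS Gm Ge Gd] := gG.
have imS : subspace (lin_im f) by apply: subspace_image.
have kerS : subspace (lin_ker f) by apply: subspace_preimage; apply: subspace0.
apply: dimq_leP => // u _ uI.
have [k0 uG] := growth_common (kappa + e * delta).+1 u gG.
(* The family of size p at level t is rebuilt at level t + 1 from the images
   of the vectors independent modulo the kernel, together with u. *)
have key t : exists p v, [/\ (t * (e * delta).+1 <= p)%N,
    forall i, (i < p)%N -> G (k0 + t * delta)%N (v i) & indep_mod [set 0] p v].
  elim: t => [|t [p [v [tp vG vI]]]].
    by exists 0%N, (fun=> 0); split=> // c _ [].
  set k := (k0 + t * delta)%N in vG.
  have dG : dimq_le (lin_ker f) (G k) (e * k.+1).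
    by apply: dimq_leS (Gd k) => // _ ->; apply: subsp0.
  have [r [y [_ yG yI yS]]] := dimq_le_basis kerS dG.
  have pr : (p <= r + kappa)%N.
    by apply: indep_le_dimq (subspace0 V) (dimq_le_trans _ dker) vG vI;
      exists y.
  exists (r + (kappa + e * delta).+1)%N,
    (fun i => if (i < r)%N then f (y i) else u (i - r)%N); split.
  - by rewrite mulSn; lia.
  - move=> i ir; rewrite mulSn addnCA addnC; case: ifP => [/yG /fG //|ni].
    apply: Gm (uG _ _); last by lia.
    by rewrite /k; lia.
  - move=> c; pose c' i := c (i + r)%N.
    have -> : \sum_(i < r + (kappa + e * delta).+1) c i *:
       (if (i < r)%N then f (y i) else u (i - r)%N)
      = f (\sum_(i < r) c i *: y i) + \sum_(i < (kappa + e * delta).+1) c' i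
        *: u i.
      rewrite linear_comb -(sum_concat r _ c c' (f \o y));
        apply: eq_bigr => i _.
      by case: ltnP => // /subnK E; rewrite /c' E.
    set a := f _; set b := (X in a + X) => ab0.
    have c'0 : forall i, (i < (kappa + e * delta).+1)%N -> c' i = 0.
      apply: uI; rewrite -/b; exists (- \sum_(i < r) c i *: y i) => //.
      by rewrite linearN; apply/eqP; rewrite -/a eq_sym -addr_eq0 addrC;
        apply/eqP.
    have b0 : b = 0 by rewrite /b big1 // => i _; rewrite c'0 ?scale0r.
    have a0 : a = 0 by rewrite -[RHS]ab0 b0 addr0.
    move=> i ip; case: (ltnP i r) => ir; first by apply: yI ir.
    by have := c'0 (i - r)%N; rewrite /c' subnK //; apply; lia.
have [p [v [tp vG vI]]] := key (e * k0.+1).+1.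
have := indep_le_dimq (subspace0 V) (Gd _) vG vI.
nia.
Qed.

End Subspaces.

(** * Quotient modules and composition series *)

Section Keyed.
Variables (R : nzRingType) (M : lmodType R) (N : {pred M})
  (NS : submod_closed N).

(** The predicate carries its closure proof, so that the closure structure can
    be inferred for an arbitrary submodule. *)
Definition submod_pred of submod_closed N : {pred M} := N.

HB.instance Definition _ := GRing.isSubmodClosed.Build R M (submod_pred NS) NS.

End Keyed.

Section QuotientModule.
Local Open Scope quotient_scope.
Variables (R : nzRingType) (M : lmodType R) (N0 : {pred M}).
Hypothesis NS : submod_closed N0.
Local Notation N := (submod_pred NS).

Definition congr_mod (x y : M) : bool := x - y \in N.

Lemma congr_mod_equiv : equiv_class_of congr_mod.
Proof.
split=> [x|x y|y x z]; rewrite /congr_mod ?subrr ?rpred0 //.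
  by rewrite -opprB rpredN.
by move=> xy yz; rewrite -(subrKA y) rpredD.
Qed.

Canonical congr_mod_rel := EquivRelPack congr_mod_equiv.

Definition quot_module : Type := {eq_quot congr_mod}.
HB.instance Definition _ := Choice.on quot_module.
HB.instance Definition _ := EqQuotient.on quot_module.

Definition quot_pi (x : M) : quot_module := \pi x.

Lemma quot_piP x y : quot_pi x = quot_pi y <-> x - y \in N.
Proof. by split=> [/eqmodP //|xy]; apply/eqmodP. Qed.

Lemma quot_pi_surj q : exists x, quot_pi x = q.
Proof. by exists (repr q); rewrite /quot_pi reprK. Qed.

Lemma quot_repr x : repr (quot_pi x) - x \in N.
Proof. by apply/quot_piP; rewrite /quot_pi reprK. Qed.

Definition quot_add (p q : quot_module) := quot_pi (repr p + repr q).
Definition quot_opp (p : quot_module) := quot_pi (- repr p).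
Definition quot_scale (a : R) (p : quot_module) := quot_pi (a *: repr p).

Lemma quot_addE x y : quot_add (quot_pi x) (quot_pi y) = quot_pi (x + y).
Proof. by apply/quot_piP; rewrite opprD addrACA rpredD ?quot_repr. Qed.
Lemma quot_oppE x : quot_opp (quot_pi x) = quot_pi (- x).
Proof. by apply/quot_piP; rewrite -opprD rpredN quot_repr. Qed.
Lemma quot_scaleE a x : quot_scale a (quot_pi x) = quot_pi (a *: x).
Proof. by apply/quot_piP; rewrite -scalerBr rpredZ ?quot_repr. Qed.

Let addA : associative quot_add.
Proof.
move=> p q r; have [[x <-] [y <-] [z <-]] := And3 (quot_pi_surj p)
  (quot_pi_surj q) (quot_pi_surj r).
by rewrite !quot_addE addrA.
Qed.
Let addC : commutative quot_add.
Proof. by move=> p q; rewrite /quot_add addrC. Qed.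
Let add0 : left_id (quot_pi 0) quot_add.
Proof. by move=> p; have [x <-] := quot_pi_surj p; rewrite quot_addE add0r. Qed.
Let addN : left_inverse (quot_pi 0) quot_opp quot_add.
Proof.
by move=> p; have [x <-] := quot_pi_surj p; rewrite quot_oppE quot_addE addNr.
Qed.

HB.instance Definition _ := GRing.isZmodule.Build quot_module addA addC add0
  addN.

Let scaleA a b p : quot_scale a (quot_scale b p) = quot_scale (a * b) p.
Proof. by have [x <-] := quot_pi_surj p; rewrite !quot_scaleE scalerA. Qed.
Let scale1 : left_id 1 quot_scale.
Proof. by move=> p; have [x <-] := quot_pi_surj p;
  rewrite quot_scaleE scale1r. Qed.
Let scaleDr : right_distributive quot_scale +%R.
Proof.
move=> a p q; have [[x <-] [y <-]] := conj (quot_pi_surj p) (quot_pi_surj q).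
by rewrite [quot_pi x + _]quot_addE !quot_scaleE [RHS]quot_addE scalerDr.
Qed.
Let scaleDl p : {morph quot_scale^~ p : a b / a + b}.
Proof.
move=> a b; have [x <-] := quot_pi_surj p.
by rewrite !quot_scaleE [RHS]quot_addE scalerDl.
Qed.

HB.instance Definition _ := GRing.Zmodule_isLmodule.Build R quot_module
  scaleA scale1 scaleDr scaleDl.

Let quot_pi_linear : linear quot_pi.
Proof.
by move=> a x y; rewrite -quot_addE -quot_scaleE.
Qed.

HB.instance Definition _ :=
  GRing.isLinear.Build R M quot_module *:%R quot_pi quot_pi_linear.

End QuotientModule.

Lemma quotient_module (R : nzRingType) (M : lmodType R) (N : {pred M}) :
  submod_closed N -> exists (Q : lmodType R) (f : {linear M -> Q}),
    (forall q, exists m, f m = q) /\ (forall m, f m = 0 <-> m \in N).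
Proof.
move=> NS; exists (quot_module NS), (@quot_pi R M N NS); split.
  exact: quot_pi_surj.
move=> m; split=> [/(quot_piP NS m 0)|mN]; first by rewrite subr0.
by apply/(quot_piP NS m 0); rewrite subr0.
Qed.

Section Submodule.
Variables (R : nzRingType) (M : lmodType R) (P : {pred M}).
Hypothesis PS : submod_closed P.

Definition submod_type : Type := {x : M | x \in submod_pred PS}.
HB.instance Definition _ := SubChoice.on submod_type.
HB.instance Definition _ := [SubChoice_isSubLmodule of submod_type by <:].

End Submodule.

Lemma submodule_as_module (R : nzRingType) (M : lmodType R) (P : {pred M}) :
  submod_closed P -> exists (Q : lmodType R) (g : {linear Q -> M}),
    injective g /\ (forall m, m \in P <-> exists q, g q = m).
Proof.
move=> PS; exists (submod_type PS), (\val : submod_type PS -> M); split.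
  exact: val_inj.
by move=> m; split=> [mP|[q <-]]; [exists (exist _ m mP) | exact: valP].
Qed.

(** The simple module is the submodule [P / N] of [M / N]; it is returned with
    the maps [f : M -> M / N] and [g : P / N -> M / N] because there is no
    natural linear map from [M] to [P / N]. *)
Lemma simple_factor_module (R : nzRingType) (M : lmodType R) (N P : {pred M}) :
  submod_closed N -> submod_closed P -> simple_factor N P ->
  exists (Q' Q : lmodType R) (f : {linear M -> Q'}) (g : {linear Q -> Q'}),
    [/\ simple_module Q, injective g, (forall m, f m = 0 <-> m \in N),
        (forall m, m \in P -> exists q, g q = f m) &
        (forall q, exists2 m, m \in P & g q = f m)].
Proof.
move=> NS PS [NP PN NPmax].
have [Q' [f [f_surj fN]]] := quotient_module NS.
pose P' : {pred Q'} := fun q => `[< exists2 m, m \in P & f m = q >].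
have P'S : submod_closed P'.
  split; first by apply/asboolP; exists 0; rewrite ?linear0 ?PS.1.
  move=> a _ _ /asboolP [m mP <-] /asboolP [n nP <-]; apply/asboolP.
  by exists (a *: m + n); rewrite ?linearP // PS.2.
have [Q [g [g_inj gP']]] := submodule_as_module P'S.
have fg m : m \in P -> exists q, g q = f m.
  by move=> mP; apply/gP'; apply/asboolP; exists m.
have gf q : exists2 m, m \in P & g q = f m.
  have /gP' /asboolP [m mP mq] : exists q', g q' = g q by exists q.
  by exists m.
exists Q', Q, f, g; split=> //; split.
  have /existsNP [m /not_implyP [mP mN]] := PN.
  have [q qm] := fg m mP; exists q; apply/eqP => q0; apply: mN.
  by apply/fN; rewrite -qm q0 linear0.
move=> S SS.
pose S' : {pred M} := fun m => `[< m \in P /\ exists2 q, q \in S & g q = f m >].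
have S'S : submod_closed S'.
  split; first by apply/asboolP; split; [exact: PS.1 | exists 0;
    rewrite ?linear0 ?SS.1].
  move=> a m n /asboolP [mP [q qS qm]] /asboolP [nP [r rS rn]]; apply/asboolP.
  split; first exact: PS.2.
  by exists (a *: q + r); [exact: SS.2 | rewrite !linearP qm rn].
have NS' : {subset N <= S'}.
  move=> m mN; apply/asboolP; split; first exact: NP.
  by exists 0; [exact: SS.1 | rewrite linear0; apply/esym/fN].
have S'P : {subset S' <= P} by move=> m /asboolP [].
case: (NPmax S' S'S NS' S'P) => E; [left|right] => q.
  apply/idP/idP => [qS|/eqP ->]; last exact: SS.1.
  have [m mP qm] := gf q.
  have /fN m0 : m \in N by rewrite -E; apply/asboolP; split=> //; exists q.
  by apply/eqP/g_inj; rewrite qm m0 linear0.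
have [m mP qm] := gf q.
have : m \in S' by rewrite E.
by case/asboolP=> _ [r rS]; rewrite -qm => /g_inj <-; rewrite rS.
Qed.

Section Restriction.
Variables (K : fieldType) (A : algType K).

Section Map.
Variables (M Q : lmodType A) (f : {linear M -> Q}).

Definition restr_map (m : restr M) : restr Q := f m.

Let restr_map_linear : linear restr_map.
Proof.
move=> k m n; rewrite /restr_map.
by change (f (k%:A *: (m : M) + (n : M)) = k%:A *: f m + f n); rewrite linearP.
Qed.
HB.instance Definition _ := GRing.isLinear.Build K (restr M) (restr Q) *:%R
  restr_map restr_map_linear.

Lemma act_restr_map a m : restr_map (act M a m) = act Q a (restr_map m).
Proof. by rewrite /restr_map /act linearZ. Qed.

End Map.

Lemma restr_scaleE (M : lmodType A) (k : K) (m : restr M) :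
  k *: m = act M k%:A m.
Proof. by []. Qed.

Definition restr_set (M : lmodType A) (S : {pred M}) : set (restr M) :=
  fun m => (m : M) \in S.

Lemma submod_subspace (M : lmodType A) (S : {pred M}) :
  submod_closed S -> subspace (restr_set S).
Proof. by case=> S0 Sl; split=> // k u v; exact: (Sl k%:A). Qed.

Lemma lin_ker_subspace (M : lmodType A) a : subspace (lin_ker (act M a)).
Proof. by apply: subspace_preimage; apply: subspace0. Qed.

(** Along a composition series: modulo [S n], the kernel on [S n.+1] embeds in
    the kernel on the simple factor. *)
Lemma ker_finite_length (a : A) :
  (forall M : lmodType A, simple_module M -> finite_dim (lin_ker (act M a))) ->
  forall M : lmodType A, finite_length M -> finite_dim (lin_ker (act M a)).
Proof.
move=> H M [n [S [SS S0 Sn Sf]]].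
suff: exists d, dimq_le [set 0] (restr_set (S n) `&` lin_ker (act M a)) d.
  case=> d; move=> dS; apply/finite_dimP; exists d;
    apply: dimq_leS dS => // m am.
  by split=> //; rewrite /restr_set Sn.
elim: n {Sn} Sf => [|n IH] Sf.
  by exists 0%N; apply: dimq_le0 => m [mS _]; move: mS;
    rewrite /restr_set S0 => /eqP.
have [i lt_in|d dS] := IH; first by apply: Sf; apply: leqW.
have [Q' [Q [f [g [Qs g_inj fN fg gf]]]]] :=
  simple_factor_module (SS n) (SS n.+1) (Sf n (leqnn _)).
have /finite_dimP [r dQ] := H Q Qs.
have : dimq_le [set 0] (restr_map g @` lin_ker (act Q a)) r.
  by apply: dimq_le_image dQ => _ ->; rewrite linear0.
move/(dimq_le_preimage (restr_map f) (subspace0 _)) => dM.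
exists (r + d)%N; apply: (@dimq_le_transI _ _ _ (restr_set (S n))).
- exact: submod_subspace.
- by apply: subspaceI; [apply: submod_subspace | apply: lin_ker_subspace].
- apply: dimq_leS dM => m /=; first by move/fN.
  case=> /fg [q qm] am; exists q => //; apply: g_inj; rewrite linear0.
  rewrite -[g _]/(restr_map g _) act_restr_map [restr_map g q]qm.
  by rewrite -[f m]/(restr_map f m) -act_restr_map am linear0.
- by apply: dimq_leS dS => // m [mS [_ am]].
Qed.

(** The cokernel on [S n.+1] is spanned by lifts of a spanning family of the
    cokernel on the simple factor and by the cokernel on [S n]. *)
Lemma coker_finite_length (a : A) :
  (forall M : lmodType A, simple_module M -> finite_codim (lin_im (act M a))) ->
  forall M : lmodType A, finite_length M -> finite_codim (lin_im (act M a)).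
Proof.
move=> H M [n [S [SS S0 Sn Sf]]].
suff: exists d, dimq_le (act M a @` restr_set (S n)) (restr_set (S n)) d.
  case=> d dS; apply/finite_codimP; exists d; apply: dimq_leS dS.
    by move=> _ [m _ <-]; exists m.
  by move=> m _; rewrite /restr_set Sn.
elim: n {Sn} Sf => [|n IH] Sf.
  exists 0%N; apply: dimq_le0 => m; rewrite /restr_set S0 => /eqP ->.
  by exists 0; rewrite ?linear0 //; exact: (SS 0%N).1.
have [i lt_in|d [w dS]] := IH; first by apply: Sf; apply: leqW.
have [Q' [Q [f [g [Qs g_inj fN fg gf]]]]] :=
  simple_factor_module (SS n) (SS n.+1) (Sf n (leqnn _)).
have /finite_codimP [r [v vP]] := H Q Qs.
have /choice [y yP] (i : nat) : exists y, y \in S n.+1 /\ g (v i) = f y.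
  by have [y] := gf (v i); exists y.
have NP : {subset S n <= S n.+1} by case: (Sf n (leqnn _)).
pose W : set (restr M) := fun m => exists2 z, z \in S n.+1 &
   restr_set (S n) (m - act M a z).
exists (r + d)%N; apply: (@dimq_le_trans _ _ _ W).
  exists (y : nat -> restr M) => u /fg [q qu].
  have [//|c [q' _ q'P]] := vP q; exists c.
  have [z zP q'z] := gf q'; exists z => //; apply/fN.
  have -> : f (u - \sum_(i < r) c i *: (y i : restr M) - act M a z) =
      restr_map f u - restr_map f (\sum_(i < r) c i *: (y i : restr M))
        - restr_map f (act M a z) by rewrite -!linearB.
  have -> : restr_map f (\sum_(i < r) c i *: (y i : restr M)) =
            restr_map g (\sum_(i < r) c i *: v i).
    by rewrite !linear_comb; apply: eq_bigr => i _; congr (_ *: _);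
      rewrite /= /restr_map (yP i).2.
  rewrite act_restr_map [restr_map f u]/(restr_map _ _) /restr_map -qu -q'z.
  rewrite -[g q']/(restr_map g q') -[act Q' a _]act_restr_map q'P.
  by rewrite -[g q]/(restr_map g q) /restr_map -!linearB subrr linear0.
exists w => u [z zP /dS [c [z' z'P E]]]; exists c; exists (z + z' : restr M).
  by apply: (subspD (submod_subspace (SS n.+1))) => //; apply: NP.
by rewrite (linearD (act M a) z z') [X in _ + X]E addrC addrAC subrK.
Qed.

End Restriction.

(** * Pairs of operators satisfying the Weyl relation *)

Section Action.
Variables (K : fieldType) (A : algType K) (M : lmodType A).
Implicit Types (a b : A) (m : restr M).

Lemma act1 m : act M 1 m = m.
Proof. by rewrite /act scale1r. Qed.
Lemma act0 m : act M 0 m = 0.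
Proof. by rewrite /act scale0r. Qed.
Lemma actM a b m : act M (a * b) m = act M a (act M b m).
Proof. by rewrite /act scalerA. Qed.
Lemma actD a b m : act M (a + b) m = act M a m + act M b m.
Proof. by rewrite /act scalerDl. Qed.
Lemma actN a m : act M (- a) m = - act M a m.
Proof. by rewrite /act scaleNr. Qed.
Lemma actB a b m : act M (a - b) m = act M a m - act M b m.
Proof. by rewrite /act scalerBl. Qed.
Lemma actMn a n m : act M (a *+ n) m = act M a m *+ n.
Proof. by elim: n => [|n IH]; rewrite ?act0 // !mulrS actD IH. Qed.
Lemma actZ k a m : act M (k *: a) m = k *: act M a m.
Proof. by rewrite restr_scaleE -actM mulr_algl. Qed.
Lemma act_sum (I : Type) (r : seq I) (P : pred I) (F : I -> A) m :
  act M (\sum_(i <- r | P i) F i) m = \sum_(i <- r | P i) act M (F i) m.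
Proof. by apply: (big_morph (act M ^~ m)); [move=> a b;
  apply: actD | apply: act0]. Qed.

End Action.

Section Weyl.
Variables (K : fieldType) (A : algType K) (X D : A).
Hypothesis weylDX : D * X = X * D + 1.

Local Notation ev := (horner_alg X).
Implicit Types (b : {poly {poly K}}) (p q : {poly K}).

Lemma D_ev p : D * ev p = ev p * D + ev p^`().
Proof.
elim/poly_ind: p => [|p c IH]; first by rewrite deriv0 rmorph0 mulr0 mul0r
  addr0.
rewrite derivD derivM derivX derivC mulr1 addr0 !rmorphD !rmorphM /=
  !horner_algX horner_algC.
have -> : D * (ev p * X + c%:A) = ev p * (X * D + 1) + ev p^`() * X + c *: D.
  by rewrite mulrDr mulrA IH mulrDl -weylDX mulrA mulr_algr.
rewrite [(_ + c%:A) * D]mulrDl mulr_algl mulrDr mulr1 mulrA.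
by rewrite -!addrA; congr (_ + _); rewrite addrC -addrA addrCA.
Qed.

(** The element of the Weyl algebra with normally ordered coefficients [b],
    the outer variable standing for [D] and the inner one for [X]. Since the
    evaluation is not assumed injective, nonzero elements are handled through
    their symbols [b]. *)
Definition weyl (b : {poly {poly K}}) : A := \sum_(j < size b) ev b`_j * D ^+ j.

Lemma weyl_widen b n : (size b <= n)%N -> weyl b =
  \sum_(j < n) ev b`_j * D ^+ j.
Proof.
by move=> bn; rewrite (big_ord_trunc (F := fun j => ev b`_j * D ^+ j)
  bn) // => j le; rewrite nth_default ?rmorph0 ?mul0r.
Qed.

Lemma weylD b (c : {poly {poly K}}) : weyl (b + c) = weyl b + weyl c.
Proof.
rewrite !(@weyl_widen _ (maxn (size b) (size c))) ?size_polyD ?leq_maxl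
  ?leq_maxr //.
by rewrite -big_split; apply: eq_bigr => j _; rewrite coefD rmorphD mulrDl.
Qed.

Lemma weyl0 : weyl 0 = 0.
Proof. by rewrite /weyl size_poly0 big_ord0. Qed.

Lemma weylN b : weyl (- b) = - weyl b.
Proof. by apply/eqP; rewrite -addr_eq0 -weylD addNr weyl0. Qed.

Lemma weyl_cons b (c : {poly K}) : weyl (b * 'X + c%:P) = weyl b * D + ev c.
Proof.
rewrite (@weyl_widen _ (size b).+1); last first.
  by rewrite size_MXaddC; case: ifP => // /andP [/eqP -> _]; rewrite size_poly0.
rewrite big_ord_recl coefD coefMX coefC /= add0r mulr1 addrC /weyl mulr_suml.
congr (_ + _); apply: eq_bigr => j _.
by rewrite coefD coefMX coefC /= addr0 exprSr mulrA.
Qed.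

Lemma weyl_monomial (c : {poly K}) j : weyl (c%:P * 'X^j) = ev c * D ^+ j.
Proof.
elim: j => [|j IH]; first by rewrite !mulr1 -[_%:P]add0r -(mul0r 'X) weyl_cons
  weyl0 mul0r add0r.
by rewrite exprSr mulrA -[_ * 'X]addr0 -polyC0 weyl_cons rmorph0 addr0 IH
  exprSr mulrA.
Qed.

(** The commutator with [X] acts on normally ordered symbols as the derivative
    with respect to [D]. *)
Lemma weyl_mulX b : weyl b * X = weyl ('X%:P * b + b^`()).
Proof.
elim/poly_ind: b => [|b c IH]; first by rewrite mulr0 deriv0 addr0 weyl0 mul0r.
rewrite weyl_cons mulrDl -mulrA weylDX mulrDr mulr1 mulrA IH.
have -> : 'X%:P * (b * 'X + c%:P) + (b * 'X + c%:P)^`() =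
    (('X%:P * b + b^`()) * 'X + (c * 'X)%:P) + b.
  by rewrite derivD derivM derivX derivC polyCM; ring.
by rewrite [RHS]weylD weyl_cons rmorphM /= horner_algX addrAC.
Qed.

Definition in_weyl (a : A) : Prop := exists b, a = weyl b.

Lemma in_weylD a a' : in_weyl a -> in_weyl a' -> in_weyl (a + a').
Proof. by move=> [b ->] [b' ->]; exists (b + b'); rewrite weylD. Qed.

Lemma in_weyl_sum n (F : nat -> A) : (forall i, in_weyl (F i)) ->
  in_weyl (\sum_(i < n) F i).
Proof.
move=> H; elim: n => [|n IH]; first by rewrite big_ord0; exists 0;
  rewrite weyl0.
by rewrite big_ord_recr; apply: in_weylD.
Qed.

Lemma in_weyl_ev p a : in_weyl a -> in_weyl (ev p * a).
Proof.
case=> b ->; rewrite mulr_sumr.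
apply: (@in_weyl_sum _ (fun j => ev p * (ev b`_j * D ^+ j))) => j.
by rewrite mulrA -rmorphM; eexists; rewrite -weyl_monomial.
Qed.

Lemma in_weylX a : in_weyl a -> in_weyl (X * a).
Proof. by rewrite -[X in X * a](horner_algX X); apply: in_weyl_ev. Qed.

Lemma in_weylZ k a : in_weyl a -> in_weyl (k *: a).
Proof. by rewrite -mulr_algl -[k%:A](horner_algC X); apply: in_weyl_ev. Qed.

Lemma in_weyl_D a : in_weyl a -> in_weyl (D * a).
Proof.
case=> b ->; rewrite mulr_sumr.
apply: (@in_weyl_sum _ (fun j => D * (ev b`_j * D ^+ j))) => j.
rewrite mulrA D_ev mulrDl -mulrA -exprS.
by apply: in_weylD; eexists; rewrite -weyl_monomial.
Qed.

Lemma in_weyl1 : in_weyl 1.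
Proof. by exists (1%:P * 'X^0); rewrite weyl_monomial rmorph1 mulr1. Qed.

Hypothesis charK0 : [pchar K] =i pred0.

Lemma natr_neq0 n : n.+1%:R != 0 :> K.
Proof. by move/pcharf0P: charK0 => ->. Qed.

Section Module.
Variable M : lmodType A.

Definition torsion_free := forall p (m : restr M),
  p != 0 -> act M (ev p) m = 0 -> m = 0.

Lemma act_ev_poly n (c : nat -> K) (m : restr M) :
  act M (ev (\poly_(l < n) c l)) m = \sum_(l < n) c l *: act M (X ^+ l) m.
Proof.
rewrite poly_def linear_sum /= act_sum; apply: eq_bigr => l _.
by rewrite linearZ /= mulr_algl actZ rmorphXn /= horner_algX.
Qed.

Lemma ev_comm p q (m : restr M) :
  act M (ev p) (act M (ev q) m) = act M (ev q) (act M (ev p) m).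
Proof. by rewrite -!actM -!rmorphM mulrC. Qed.

Lemma act_D_ev p (m : restr M) :
  act M D (act M (ev p) m) = act M (ev p) (act M D m) + act M (ev p^`()) m.
Proof. by rewrite -actM D_ev actD actM. Qed.

Section Relations.
Variables (N n : nat) (v : nat -> restr M).

(** A [K[X]]-linear relation between the [j]-th derivatives of the [v i]. *)
Definition relation (p : nat -> {poly K}) (j : nat) : Prop :=
  \sum_(i < N) act M (ev (p i)) (act M (D ^+ j) (v i)) = 0.

(** Applying [D] to a relation between the [j]-th derivatives gives a relation
    between the next ones, up to the differentiated coefficients. *)
Lemma relation_deriv (p : nat -> {poly K}) j :
  relation p j -> relation p j.+1 -> relation (fun i => (p i)^`()) j.
Proof.
rewrite /relation => p0 p1.
have : act M D (\sum_(i < N) act M (ev (p i)) (act M (D ^+ j) (v i))) = 0.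
  by rewrite p0 linear0.
rewrite linear_sum /=; under eq_bigr => i _ do rewrite act_D_ev
  -[act M D _]actM -exprS.
by rewrite big_split /= p1 add0r.
Qed.

End Relations.

(** The rank over [K[X]] is bounded by the growth: the vectors [(v i, D v i,
    ..., D^(n-1) v i)] live in [M^n], where the multiples by polynomials of
    degree at most [k] fill a space of dimension at most [n * e * delta * k]
    up to a constant, less than the number of unknown coefficients as soon as
    there are more than [n * e * delta] vectors. *)
Lemma relation_exists (G : nat -> set (restr M)) e delta n (v : nat ->
  restr M) :
  linear_growth G e -> (forall k m, G k m -> G (k + delta)%N (act M X m)) ->
  exists p : nat -> {poly K}, (exists2 i, (i < (n * e * delta).+1)%N &
    p i != 0) /\
    forall j, (j < n)%N -> relation (n * e * delta).+1 v p j.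
Proof.
move=> gG GX; set N := _.+1; have [GS Gm Ge Gd] := gG.
pose w i := act M (D ^+ (i %/ N)) (v (i %% N)%N).
have [k0 wG] := growth_common (n * N)%N w gG.
have vG i j : (i < N)%N -> (j < n)%N -> G k0 (act M (D ^+ j) (v i)).
  move=> iN jn; have := wG (j * N + i)%N; rewrite /w divnMDl // divn_small //
    addn0.
  by rewrite modnMDl modn_small //; apply; nia.
(* The degree of the sought coefficients; this value makes the unknowns
   outnumber the equations. *)
pose k := (n * e * k0.+1)%N.
have GXl l m : G k0 m -> G (k0 + l * delta)%N (act M (X ^+ l) m).
  move=> Gm0; elim: l => [|l IH]; first by rewrite addn0 act1.
  by rewrite exprS actM mulSn [(delta + _)%N]addnC addnA; apply: GX.
have [y yP] := Gd (k0 + k * delta)%N.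
have /fin_all_exists [C CP] (t : 'I_N * 'I_k.+1 * 'I_n) : exists c : nat -> K,
    act M (X ^+ t.1.2) (act M (D ^+ t.2) (v t.1.1)) =
    \sum_(h < e * (k0 + k * delta).+1) c h *: y h.
  case: t => [[i l] j] /=.
  have [|c /eqP] := yP (act M (X ^+ l) (act M (D ^+ j) (v i))).
    apply: Gm (GXl _ _ (vG _ _ _ _)) => //.
    by rewrite leq_add2l leq_mul2r -ltnS ltn_ord orbT.
  by rewrite subr_eq0 => /eqP ->; exists c.
have [|c [[[i0 l0] c0] cC]] := @underdetermined_system K
    ('I_N * 'I_k.+1)%type ('I_n * 'I_(e * (k0 + k * delta).+1))%type
    (fun t u => C (t, u.1) u.2).
  rewrite !card_prod !card_ord /k /N; nia.
pose c' i l := if insub i is Some i' then if insub l is Some l' then c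
  (i', l') else 0 else 0.
have c'E (i : 'I_N) (l : 'I_k.+1) : c' i l = c (i, l) by rewrite /c' !valK.
exists (fun i => \poly_(l < k.+1) c' i l); split.
  exists i0 => //; apply/eqP => /polyP /(_ l0) /eqP.
  by rewrite coef_poly ltn_ord coef0 c'E (negPf c0).
move=> j jn; rewrite /relation.
under eq_bigr => i _ do rewrite act_ev_poly.
rewrite pair_big /=.
transitivity (\sum_(t : 'I_N * 'I_k.+1) \sum_(h < e * (k0 + k * delta).+1)
    (c t * C (t, Ordinal jn) h) *: y h).
  apply: eq_bigr => -[i l] _ /=; rewrite c'E (CP (i, l, Ordinal jn))
    scaler_sumr.
  by apply: eq_bigr => h _; rewrite scalerA.
rewrite exchange_big big1 // => h _; rewrite -scaler_suml.
by have /= -> := cC (Ordinal jn, h); rewrite scale0r.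
Qed.

(** An operator of order [n] has finite-dimensional kernel, as for solutions
    of ordinary differential equations. Too many solutions [v i] are related
    over [K[X]] together with their first [n - 1] derivatives, and also in
    order [n] because the equation expresses [D^n v i]. Hence the coefficients
    of a relation may be differentiated, and differentiating a relation as
    often as possible leaves constants, in contradiction with independence. *)
Lemma weyl_ker_finite (G : nat -> set (restr M)) e delta b :
  linear_growth G e -> (forall k m, G k m -> G (k + delta)%N (act M X m)) ->
  torsion_free -> b != 0 -> finite_dim (lin_ker (act M (weyl b))).
Proof.
move=> gG GX tf b0; set n := (size b).-1.
have sb : size b = n.+1 by rewrite /n prednK // lt0n size_poly_eq0.
apply/finite_dimP; exists (n * e * delta)%N; apply: dimq_leP;
  first exact: subspace0.
set N := (n * e * delta).+1 => v vK vI.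
have [p [[i0 i0N pi0] pR]] := relation_exists n v gG GX.
have relS (q : nat -> {poly K}) : (forall j, (j < n)%N -> relation N v q j) ->
    forall j, (j < n.+1)%N -> relation N v q j.
  move=> qR j; rewrite ltnS leq_eqVlt => /orP [/eqP ->|/qR //].
  apply: (tf b`_n); first by rewrite -lead_coefE lead_coef_eq0.
  have E i : (i < N)%N -> act M (ev b`_n) (act M (D ^+ n) (v i)) =
      - \sum_(j < n) act M (ev b`_j) (act M (D ^+ j) (v i)).
    move=> iN; have /eqP : act M (weyl b) (v i) = 0 by apply: vK.
    rewrite /weyl sb big_ord_recr /= actD addrC act_sum.
    rewrite actM addr_eq0 => /eqP ->; congr (- _).
    by apply: eq_bigr => k _; rewrite actM.
  rewrite linear_sum /=.
  under eq_bigr => i _ do rewrite ev_comm E // linearN linear_sum.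
  rewrite sumrN exchange_big /= big1 ?oppr0 // => k _.
  under eq_bigr => i _ do rewrite ev_comm.
  by rewrite -linear_sum (qR k) // linear0.
have derivR l : forall j, (j < n)%N -> relation N v (fun i => (p i)^`(l)) j.
  elim: l => [|l IH] j jn; first exact: pR.
  have := relation_deriv (relS _ IH j (leqW jn)) (relS _ IH j.+1 jn).
  by congr (_ = 0); apply: eq_bigr => i _; rewrite derivnS.
(* Differentiating s - 1 times kills all coefficients of less than maximal
   degree and turns the others into nonzero constants. *)
pose s := \max_(i < N) size (p i).
have [im im_max] : {im : 'I_N | s = size (p im)} by apply: eq_bigmax;
  rewrite card_ord.
have s_gt0 : (0 < s)%N.
  apply: leq_trans (leq_bigmax (F := fun i : 'I_N => size (p i)) (Ordinal i0N)).
  by rewrite lt0n size_poly_eq0.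
pose c i := ((p i)^`(s.-1))`_0.
have cE (i : 'I_N) : (p i)^`(s.-1) = (c i)%:P.
  apply/size1_polyC/leq_sizeP => j j0; rewrite coef_derivn nth_default
    ?mul0rn //.
  have : (size (p i) <= s)%N by apply: (leq_bigmax (F := fun i : 'I_N =>
    size (p i))).
  by move/leq_trans; apply; rewrite -{1}(prednK s_gt0) -addn1 leq_add2l.
have := relS _ (derivR s.-1) 0%N isT.
rewrite /relation; under eq_bigr => i _ do rewrite cE horner_algC act1
  -restr_scaleE.
move/vI => /(_ im (ltn_ord im)) /eqP; apply/negP.
rewrite /c coef_derivn addn0 ffactnn im_max -lead_coefE -mulr_natr mulf_neq0 //.
  by rewrite lead_coef_eq0 -size_poly_gt0 -im_max.
by have := fact_gt0 (size (p im)).-1; case: (_`!) => // f _; apply: natr_neq0.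
Qed.

(** For a vector [m] killed by [q(X)], commuting [D] past the powers of [q]
    only leaves the terms in which every [D] has been spent on a factor [q];
    the scalar is [(-1)^j j!]. *)
Lemma act_pow_D_annihilated q (m : restr M) j : act M (ev q) m = 0 ->
  act M (ev (q ^+ j.+1)) (act M (D ^+ j) m) = 0 /\
  exists2 k : K, k != 0 &
    act M (ev (q ^+ j)) (act M (D ^+ j) m) = k *: act M (ev (q^`() ^+ j)) m.
Proof.
move=> qm; elim: j => [|j [IH0 [k k0 IH1]]].
  by rewrite !expr1 !expr0 !rmorph1 !act1; split=> //; exists 1;
    rewrite ?oner_eq0 ?scale1r.
have step i : act M (ev (q ^+ i.+1)) (act M (D ^+ j.+1) m) =
   act M D (act M (ev (q ^+ i.+1)) (act M (D ^+ j) m)) -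
   act M (ev q^`()) (act M (ev (q ^+ i)) (act M (D ^+ j) m)) *+ i.+1.
  have -> : act M (D ^+ j.+1) m = act M D (act M (D ^+ j) m)
    by rewrite exprS actM.
  by rewrite act_D_ev deriv_exp /= rmorphMn actMn rmorphM actM addrK.
split.
  rewrite step IH0 exprS rmorphM actM IH0.
  by rewrite !linear0 mul0rn subr0.
exists (- (k *+ j.+1)); first by rewrite oppr_eq0 -mulr_natr mulf_neq0 //
  natr_neq0.
rewrite step IH0 linear0 sub0r IH1 linearZ /= -actM -rmorphM -exprS.
by rewrite scaleNr scalerMnl.
Qed.

(** A nonzero vector cannot be torsion over both [K[X]] and [K[D]]. If [q(X)]
    kills [m] and [p] has degree [d], then [q(X)^d p(D) m] is a nonzero
    multiple of [q'(X)^d m]. So the derivative [q'] kills some nonzero vector,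
    and the degree of [q] can be lowered until [q] is constant. *)
Lemma torsion_free_of_torsion :
  (forall m : restr M, exists2 p, p != 0 & act M (horner_alg D p) m = 0) ->
  torsion_free.
Proof.
move=> Dtors q m q0 qm; apply: contrapT => /eqP m0.
have [n le_n] := ubnP (size q); elim: n q m q0 qm m0 le_n => // n IH q m q0 qm
  m0 le_n.
have [sq|sq] := leqP (size q) 1.
  move: q0 qm; rewrite (size1_polyC sq) polyC_eq0 horner_algC -restr_scaleE =>
    q0 /eqP.
  by rewrite scaler_eq0 (negPf q0) (negPf m0).
have q'0 : q^`() != 0.
  apply/eqP => /polyP /(_ (size q).-2) /eqP; rewrite coef_deriv coef0.
  have -> : (size q).-2.+1 = (size q).-1 by case: (size q) sq => [|[]].
  rewrite -lead_coefE -mulr_natr mulf_eq0 lead_coef_eq0 (negPf q0) /=.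
  by apply/negP; case: (size q) sq => [|[|k]] // _; apply: natr_neq0.
have sq' : (size q^`() < n)%N by apply: leq_trans (lt_size_deriv q0) _.
have [p p0 pm] := Dtors m; set d := (size p).-1.
have sp : size p = d.+1 by rewrite prednK // size_poly_gt0.
have low i : (i < d)%N -> act M (ev (q ^+ d)) (act M (D ^+ i) m) = 0.
  move=> lt; rewrite -(subnK lt) exprD rmorphM actM.
  by rewrite (act_pow_D_annihilated i qm).1 linear0.
have [_ [k k0 kE]] := act_pow_D_annihilated d qm.
have : act M (ev (q^`() ^+ d)) m = 0.
  have : act M (ev (q ^+ d)) (act M (horner_alg D p) m) =
    0 by rewrite pm linear0.
  have -> : horner_alg D p = \sum_(i < d.+1) p`_i *: D ^+ i.
    rewrite -{1}[p]coefK poly_def sp linear_sum; apply: eq_bigr => i _.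
    by rewrite /= -mul_polyC rmorphM /= horner_algC mulr_algl rmorphXn /=
      horner_algX.
  rewrite act_sum linear_sum big_ord_recr /= big1 ?add0r => [|i _]; last first.
    by rewrite actZ linearZ /= low ?scaler0.
  rewrite actZ linearZ /= kE scalerA => /eqP;
    rewrite scaler_eq0 mulf_eq0 (negPf k0) orbF.
  by rewrite -lead_coefE lead_coef_eq0 (negPf p0) => /eqP.
elim: {sp low kE} d => [|d IHd]; first by rewrite rmorph1 act1; apply/eqP.
rewrite exprS rmorphM actM => H.
have [/IHd //|nz] := pselect (act M (ev (q^`() ^+ d)) m = 0).
by apply: (IH q^`() _ q'0 H _ sq'); apply/eqP.
Qed.
End Module.
End Weyl.

(** * Algebras with the relations of polynomial integro-differential operators *)

Definition generates (K : fieldType) (A : algType K) (x d s : A) : Prop :=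
  forall S : {pred A}, subalg_closed S -> x \in S -> d \in S -> s \in S ->
  forall a, a \in S.

(** The relations of multiplication by the variable, derivation and
    integration, with two realizations of interest: the algebra of
    integro-differential operators and its opposite. *)
Definition integro_differential (K : fieldType) (A : algType K) (x d s : A) :
  Prop :=
  [/\ d * s = 1, d * x = x * d + 1, s * d * x = x, s * d != 1 &
    generates x d s].

(** The elements [s^i d^j - s^(i+1) d^(j+1)] multiply like matrix units; for
    derivation and integration of polynomials their span is the ideal [F]. *)
Definition span_units (K : fieldType) (A : algType K) (d s : A) : set A :=
  [set a | exists n (c : 'I_n -> 'I_n -> K), a =
     \sum_(i < n) \sum_(j < n) c i j *: (s ^+ i * d ^+ j - s ^+ i.+1 * d ^+
       j.+1)].

Section IntegroDifferential.
Variables (K : fieldType) (A : algType K) (x d s : A).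
Hypothesis relA : integro_differential x d s.

Let ds1 : d * s = 1. Proof. by case: relA. Qed.
Let dx : d * x = x * d + 1. Proof. by case: relA. Qed.
Let sdx : s * d * x = x. Proof. by case: relA. Qed.
Let gen : generates x d s. Proof. by case: relA. Qed.

(* In the algebra acting on polynomials, e is the evaluation at 0. *)
Let e := 1 - s * d.
Let es : e * s = 0. Proof. by rewrite mulrBl mul1r -mulrA ds1 mulr1 subrr. Qed.
Let ex : e * x = 0. Proof. by rewrite mulrBl mul1r sdx subrr. Qed.
Let de : d * e = 0. Proof. by rewrite mulrBr mulr1 mulrA ds1 mul1r subrr. Qed.

Lemma dpow_x k : d ^+ k * x = x * d ^+ k + d ^+ k.-1 *+ k.
Proof.
elim: k => [|k IH]; first by rewrite mul1r mulr1 mulr0n addr0.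
rewrite exprS -mulrA IH mulrDr mulrA dx mulrDl mul1r -mulrA -exprS mulrnAr
  -addrA.
by case: k {IH} => [|k]; rewrite ?mulr0n ?addr0 // -exprS -mulrS.
Qed.

Lemma e_dpow_x k : e * d ^+ k * x = (e * d ^+ k.-1) *+ k.
Proof. by rewrite -mulrA dpow_x mulrDr mulrA ex mul0r add0r mulrnAr. Qed.

Definition stable (M : lmodType A) (S : set (restr M)) : Prop :=
  [/\ forall m, S m -> S (act M x m), forall m, S m -> S (act M d m) &
      forall m, S m -> S (act M s m)].

Lemma stable_act (M : lmodType A) (S : set (restr M)) : subspace S ->
  stable S ->
  forall a m, S m -> S (act M a m).
Proof.
move=> SS [Sx Sd Ss] a; pose P : {pred A} := fun a =>
  `[< forall m, S m -> S (act M a m) >].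
suff: a \in P by move/asboolP.
apply: gen; try exact/asboolP.
split; first by apply/asboolP => m; rewrite act1.
  move=> k b c /asboolP bP /asboolP cP; apply/asboolP => m Sm.
  by rewrite actD actZ; exact: (SS.2 k _ _ (bP m Sm) (cP m Sm)).
move=> b c /asboolP bP /asboolP cP; apply/asboolP => m Sm.
by rewrite actM; apply/bP/cP.
Qed.

Lemma simple_stable (M : lmodType A) (S : set (restr M)) m0 : simple_module M ->
  subspace S -> stable S -> m0 != 0 -> S m0 -> forall m, S m.
Proof.
move=> [_ Ms] SS St m00 Sm0 m; pose P : {pred M} := fun m => `[< S m >].
have PS : submod_closed P.
  split; first by apply/asboolP; exact: (subsp0 SS).
  move=> a u v /asboolP Su /asboolP Sv; apply/asboolP.
  by apply: (subspD SS (u := act M a u)) => //; apply: stable_act.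
case: (Ms P PS) => E; last by apply/asboolP; rewrite -[asbool _]/(m \in P) E.
have : m0 \in P by apply/asboolP.
by rewrite E inE (negPf m00).
Qed.

(** Since left multiplication by the generators produces the whole algebra
    from [1], properties of elements can be proved by induction on their
    leftmost factor. *)
Lemma left_induction (S : set A) : S 1 -> (forall k a b, S a -> S b ->
  S (k *: a + b)) ->
  (forall a, S a -> S (x * a)) -> (forall a, S a -> S (d * a)) ->
  (forall a, S a -> S (s * a)) -> forall a, S a.
Proof.
move=> S1 Sl Sx Sd Ss a; rewrite -[a]mulr1.
apply: (@stable_act A^o (S : set (restr A^o))) => //.
  split; first by have := Sl (-1) 1 1 S1 S1; rewrite scaleN1r addNr.
  by move=> k u v Su Sv; have := Sl k u v Su Sv;
    rewrite -[k *: (u : A)]mulr_algl.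
Qed.

(** Left multiplication by a power of [d] cancels the integrations: a subspace
    closed under [x] and [d] that contains [1], such as the Weyl algebra,
    contains a multiple [d ^+ k * a] of every element. *)
Lemma normal_form (S : set A) : S 1 -> (forall k a b, S a -> S b ->
  S (k *: a + b)) ->
  (forall a, S a -> S (x * a)) -> (forall a, S a -> S (d * a)) ->
  forall a, exists k, S (d ^+ k * a).
Proof.
move=> S1 Sl Sx Sd.
have SdX k a : S a -> S (d ^+ k * a).
  by move=> Sa; elim: k => [|k IH]; rewrite ?mul1r // exprS -mulrA; apply: Sd.
apply: left_induction; first by exists 0%N; rewrite mul1r.
- move=> c a b [k Sa] [l Sb]; exists (k + l)%N; rewrite mulrDr -scalerAr.
  apply: Sl; first by rewrite addnC exprD -mulrA; apply: SdX.
  by rewrite exprD -mulrA; apply: SdX.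
- move=> a [k Sa]; exists k.+1; rewrite mulrA dpow_x mulrDl addrC /=.
  rewrite mulrnAl -scaler_nat; apply: Sl => //.
  by rewrite -mulrA; apply: Sx; rewrite exprS -mulrA; apply: Sd.
- by move=> a [k Sa]; exists k; rewrite mulrA -exprSr exprS -mulrA; apply: Sd.
- by move=> a [k Sa]; exists k.+1; rewrite mulrA exprSr -[_ * d * s]mulrA ds1
  mulr1.
Qed.

Let unit_ i j := s ^+ i * d ^+ j - s ^+ i.+1 * d ^+ j.+1.

Let unitE i j : unit_ i j = s ^+ i * e * d ^+ j.
Proof. by rewrite /unit_ mulrBr mulr1 mulrBl exprSr exprS !mulrA. Qed.

Local Notation F := (span_units d s).

Lemma span_unitsP a : F a <-> exists n (c : nat -> nat -> K),
  a = \sum_(i < n) \sum_(j < n) c i j *: unit_ i j.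
Proof.
split=> [[n [c ->]]|[n [c ->]]]; last by exists n, (fun i j : 'I_n => c i j).
exists n, (fun i j => if insub i is Some i' then if insub j is Some j' then c
  i' j' else 0 else 0).
by apply: eq_bigr => i _; apply: eq_bigr => j _; rewrite !valK.
Qed.

Lemma span_units_widen n N (c : nat -> nat -> K) : (n <= N)%N ->
  \sum_(i < n) \sum_(j < n) c i j *: unit_ i j =
  \sum_(i < N) \sum_(j < N) (if (i < n)%N && (j < n)%N then c i j else 0) *:
    unit_ i j.
Proof.
move=> nN; rewrite [RHS](big_ord_trunc (F := fun i => \sum_(j < N)
  (if (i < n)%N && (j < n)%N then c i j else 0) *: unit_ i j) nN); last first.
  by move=> i; rewrite ltnNge => ->; rewrite big1 // => j _; rewrite scale0r.
apply: eq_bigr => i _; rewrite ltn_ord /=.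
rewrite [RHS](big_ord_trunc (F := fun j => (if (j < n)%N then c i j else 0) *:
  unit_ i j) nN).
  by apply: eq_bigr => j _; rewrite ltn_ord.
by move=> j; rewrite ltnNge => ->; rewrite scale0r.
Qed.

Lemma span_unitsD k a b : F a -> F b -> F (k *: a + b).
Proof.
move=> /span_unitsP [m [c ->]] /span_unitsP [n [c' ->]]; apply/span_unitsP.
rewrite (span_units_widen c (leq_addr n m)) (span_units_widen c'
  (leq_addl m n)).
pose trunc n (c : nat -> nat -> K) i j := if (i < n)%N &&
  (j < n)%N then c i j else 0.
exists (m + n)%N, (fun i j => k * trunc m c i j + trunc n c' i j);
  rewrite scaler_sumr -big_split.
apply: eq_bigr => i _; rewrite scaler_sumr -big_split; apply: eq_bigr => j _.
by rewrite /= scalerA -scalerDl.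
Qed.

Lemma span_units0 : F 0.
Proof. by apply/span_unitsP; exists 0%N, (fun _ _ => 0); rewrite big_ord0. Qed.

Lemma span_units_mem i j : F (s ^+ i * e * d ^+ j).
Proof.
apply/span_unitsP; rewrite -unitE.
exists (maxn i j).+1, (fun i' j' => ((i' == i) && (j' == j))%:R).
have li : (i < (maxn i j).+1)%N by rewrite ltnS leq_maxl.
have lj : (j < (maxn i j).+1)%N by rewrite ltnS leq_maxr.
rewrite (bigD1 (Ordinal li)) //= [X in _ + X]big1 ?addr0; last first.
  move=> i' /negPf; rewrite -val_eqE /= => ->.
  by rewrite big1 // => j' _; rewrite scale0r.
rewrite (bigD1 (Ordinal lj)) //= [X in _ + X]big1 ?addr0.
  by rewrite !eqxx scale1r.
by move=> j' /negPf; rewrite -val_eqE /= => ->; rewrite andbF scale0r.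
Qed.

(** The elements [e * d ^+ j] span a right ideal, because [e * s = e * x = 0]
    makes every factor to the right of [d ^+ j] change [j] only. *)
Lemma span_units_mulr i j a : F (s ^+ i * e * d ^+ j * a).
Proof.
move: j; apply: (@left_induction (fun a => forall j, F (s ^+ i * e * d ^+
  j * a))).
- by move=> j; rewrite mulr1; apply: span_units_mem.
- by move=> k b c Fb Fc j; rewrite mulrDr -scalerAr; apply: span_unitsD.
- move=> b Fb j.
  have -> : s ^+ i * e * d ^+ j * (x * b) = (s ^+ i * e * d ^+ j.-1 * b) *+ j.
    by rewrite -!mulrA [d ^+ j * _]mulrA [e * _]mulrA [e * _]mulrA e_dpow_x
      mulrnAl mulrnAr !mulrA.
  by rewrite -scaler_nat -[_ *: _]addr0; apply: span_unitsD (span_units0).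
- by move=> b Fb j; have := Fb j.+1; rewrite exprSr !mulrA.
- move=> b Fb [|j]; last by have := Fb j; rewrite exprSr -!mulrA [d * _]mulrA
  ds1 mul1r.
  by rewrite mulr1 mulrA -[_ * e * s]mulrA es mulr0 mul0r; apply: span_units0.
Qed.

Lemma telescope_units k a :
  a = s ^+ k * d ^+ k * a + \sum_(i < k) s ^+ i * e * d ^+ i * a.
Proof.
elim: k => [|k IH]; first by rewrite big_ord0 !mul1r addr0.
rewrite big_ord_recr /= addrCA -mulrDl.
suff -> : s ^+ k.+1 * d ^+ k.+1 + s ^+ k * e * d ^+ k = s ^+ k * d ^+
  k by rewrite addrC.
by rewrite -unitE /unit_ addrC subrK.
Qed.

(** The elements outside [F] survive multiplication by powers of [d], as [1 -
    s ^+ k * d ^+ k] is the sum of the first [k] diagonal matrix units. *)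
Lemma span_units_of_kill k a : d ^+ k * a = 0 -> F a.
Proof.
move=> ka; rewrite (telescope_units k a) -mulrA ka mulr0 add0r.
elim/big_ind: _ => [|b c Fb Fc|i _]; first exact: span_units0.
  by rewrite -[b]scale1r; apply: span_unitsD.
exact: span_units_mulr.
Qed.

(** A matrix unit [s ^+ i * e * d ^+ j] factors through the image of [e],
    which lies in the kernel of [d]. *)
Lemma compact_span_units (M : lmodType A) a : F a ->
  finite_dim (lin_ker (act M d)) -> finite_dim (lin_im (act M a)).
Proof.
move=> /span_unitsP [n [c ->]] /finite_dimP [r dK]; apply/finite_dimP.
have fdD b b' : (exists k, dimq_le [set 0] (lin_im (act M b)) k) ->
    (exists k, dimq_le [set 0] (lin_im (act M b')) k) ->
    exists k, dimq_le [set 0] (lin_im (act M (b + b'))) k.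
  case=> k [v vP] [k' db']; exists (k + k')%N; apply: dimq_le_trans db'.
  exists v => _ [m _ <-]; have [|c' c'P] := vP (act M b m); first by exists m.
  by exists c'; exists m => //=; rewrite actD addrAC [X in _ = X + _]c'P add0r.
have fd0 : exists k, dimq_le [set 0] (lin_im (act M 0)) k.
  by exists 0%N; apply: dimq_le0 => _ [m _ <-]; rewrite /= act0.
elim/big_ind: _ => [|b b'|i _]; [exact: fd0 | exact: fdD |].
elim/big_ind: _ => [|b b'|j _]; [exact: fd0 | exact: fdD |].
exists r; rewrite unitE scalerAl scalerAl.
have : dimq_le [set 0] (act M (c i j *: s ^+ i) @` lin_ker (act M d)) r.
  by apply: dimq_le_image dK => _ ->; rewrite linear0.
apply: dimq_leS => // _ [m _ <-]; exists (act M (e * d ^+ j) m).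
  by rewrite /lin_ker /= -actM mulrA de mul0r act0.
by rewrite -actM mulrA.
Qed.

Definition cyclic (M : lmodType A) (m : restr M) := forall u, exists a, u =
  act M a m.

Lemma simple_cyclic (M : lmodType A) (m : restr M) :
  simple_module M -> m != 0 -> cyclic m.
Proof.
move=> Ms m0; apply: (simple_stable Ms _ _ m0); last by exists 1; rewrite act1.
  split; first by exists 0; rewrite act0.
  by move=> k _ _ [b ->] [b' ->]; exists (k *: b + b'); rewrite actD actZ.
split=> _ [b ->]; [exists (x * b) | exists (d * b) | exists (s * b)];
  exact/esym/actM.
Qed.

(** For a generator [m] killed by [d] the vectors [e d^j u] all lie in [K m]:
    this property of [u] is stable under the generators of the algebra, and
    for [u] in the kernel of [d] the vector [e u] is [u]. *)
Lemma ker_d_cyclic (M : lmodType A) (m u : restr M) : cyclic m ->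
  act M d m = 0 -> act M d u = 0 -> exists c : K, u = c *: m.
Proof.
move=> mgen dm du.
pose S : set (restr M) := fun u => forall j, exists c : K, act M (e * d ^+ j)
  u = c *: m.
have SS : subspace S.
  split=> [j|k u1 u2 Su1 Su2 j]; first by exists 0; rewrite linear0 scale0r.
  have [[c cE] [c' c'E]] := conj (Su1 j) (Su2 j).
  by exists (k * c + c'); rewrite linearP /= cE c'E scalerDl scalerA.
have St : stable S.
  split=> w Sw j.
  - have [c cE] := Sw j.-1; exists (j%:R * c).
    by rewrite -actM e_dpow_x actMn cE -scalerA scaler_nat.
  - by have [c cE] := Sw j.+1; exists c; rewrite -actM -mulrA -exprSr.
  - case: j => [|j]; first by exists 0; rewrite -actM mulr1 es act0 scale0r.
    have [c cE] := Sw j; exists c.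
    by rewrite -actM exprSr -!mulrA ds1 mulr1.
have e_fix w : act M d w = 0 -> act M e w = w.
  by move=> dw; rewrite actB act1 actM dw linear0 subr0.
have Sm : S m.
  move=> [|j]; first by exists 1; rewrite mulr1 e_fix // scale1r.
  by exists 0; rewrite exprSr mulrA actM dm linear0 scale0r.
have [a uE] := mgen u; have [c] := stable_act SS St a Sm 0%N.
by rewrite -uE mulr1 e_fix //; exists c.
Qed.

Lemma ker_d_simple (M : lmodType A) : simple_module M ->
  dimq_le [set 0] (lin_ker (act M d)) 1.
Proof.
move=> Ms; have [[m [dm m0]]|none] := pselect (exists m : restr M, act M d m =
  0 /\ m != 0).
  exists (fun=> m) => u du.
  have [c ->] := ker_d_cyclic (simple_cyclic Ms m0) dm du.
  by exists (fun=> c); rewrite big_ord1 subrr.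
apply: (@dimq_le_mono _ _ _ _ 0) => //; apply: dimq_le0 => m dm.
by apply: contrapT => /eqP m0; apply: none; exists m.
Qed.

Lemma ker_dpow_simple (M : lmodType A) k : simple_module M ->
  dimq_le [set 0] (lin_ker (act M (d ^+ k))) k.
Proof.
move=> Ms; elim: k => [|k IH].
  by apply: dimq_le0 => m; rewrite /lin_ker /= act1.
rewrite -[X in dimq_le _ _ X]addn1.
have := dimq_le_preimage (act M d) (subspace0 _) IH => dk.
apply: dimq_le_trans (ker_d_simple Ms); apply: dimq_leS dk => // m.
by rewrite /lin_ker /= exprSr actM.
Qed.

(** No vector of a simple module generates a free module over the Weyl
    algebra. Indeed, unless [x m = 0], the vector [m] lies in the submodule
    generated by [x m], say [m = c x m]; after multiplication by a power of
    [d] this becomes the equation [(d^k - w x) m = 0] with [w] in the Weyl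
    algebra; the symbol is nonzero since the leading coefficient of [w x] is
    divisible by the variable. *)
Lemma weyl_annihilator (M : lmodType A) (m : restr M) : simple_module M ->
  m != 0 ->
  exists2 b, b != 0 & act M (weyl x d b) m = 0.
Proof.
move=> Ms m0.
have [xm|xm] := eqVneq (act M x m) 0.
  exists (('X : {poly K})%:P); first by rewrite polyC_eq0 polyX_eq0.
  by rewrite -[_%:P]mulr1 -(expr0 'X) weyl_monomial // mulr1 horner_algX.
have [c mE] := simple_cyclic Ms xm m.
have [k [b bE]] : exists k, in_weyl x d (d ^+ k * c).
  apply: normal_form => [|k a b aW bW|a|a]; first exact: in_weyl1.
  - by apply: in_weylD => //; apply: in_weylZ.
  - exact: in_weylX.
  - exact: in_weyl_D.
exists ('X^k - ('X%:P * b + b^`())); last first.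
  rewrite weylD weylN -weyl_mulX // -bE -['X^k]mul1r -polyC1 weyl_monomial //
    rmorph1 mul1r.
  by rewrite actB 2!actM -mE subrr.
rewrite subr_eq0; apply/eqP => /esym.
have [->|b0] := eqVneq b 0; first by rewrite mulr0 deriv0 addr0 => /eqP;
  rewrite eq_sym expf_eq0 polyX_eq0 andbF.
move=> /(congr1 lead_coef); rewrite lead_coefDl; last first.
  by rewrite mul_polyC size_scale ?polyX_eq0 // lt_size_deriv.
rewrite lead_coefXn lead_coefM lead_coefC => /(congr1 (size : {poly K} -> nat)).
rewrite mulrC size_mulX ?lead_coef_eq0 // size_poly1 => -[] /eqP.
by rewrite size_poly_eq0 lead_coef_eq0 (negPf b0).
Qed.

End IntegroDifferential.

(** * Growth of simple modules and the Fredholm property *)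

Section WeightFiltration.
Variables (K : fieldType) (A : algType K) (X D : A).
Hypothesis weylDX : D * X = X * D + 1.
Variables (M : lmodType A) (v : restr M) (L : nat).

Local Notation ev := (horner_alg X).

(** The span of the [X^i D^j v] of weight [i + L j < k]. It is given as an
    intersection of subspaces, so that inclusions are checked on generators.
    *)
Definition wspan (k : nat) : set (restr M) := fun u =>
  forall S : set (restr M), subspace S ->
  (forall i j, (i + L * j < k)%N -> S (act M (X ^+ i) (act M (D ^+ j) v))) ->
    S u.

Lemma wspan_subspace k : subspace (wspan k).
Proof.
split=> [S SS _|c u w Wu Ww S SS Sg]; first exact: (subsp0 SS).
by apply: SS.2; [apply: Wu | apply: Ww].
Qed.

Lemma wspan_gen k i j : (i + L * j < k)%N ->
  wspan k (act M (X ^+ i) (act M (D ^+ j) v)).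
Proof. by move=> lt S _ Sg; apply: Sg. Qed.

Lemma wspan_mono k l : (k <= l)%N -> wspan k `<=` wspan l.
Proof.
move=> kl u Wu; apply: (Wu (wspan l)) => [|i j lt]; first exact: wspan_subspace.
by apply: wspan_gen; apply: leq_trans kl.
Qed.

Lemma wspan_X k u : wspan k u -> wspan k.+1 (act M X u).
Proof.
move=> Wu; apply: (Wu (act M X @^-1` wspan k.+1)).
  exact: subspace_preimage (wspan_subspace _).
by move=> i j lt; rewrite /= -actM -exprS; apply: wspan_gen; rewrite addSn.
Qed.

Lemma wspan_XX a k u : wspan k u -> wspan (a + k)%N (act M (X ^+ a) u).
Proof.
move=> Wu; elim: a => [|a IH]; first by rewrite act1.
by rewrite exprS actM addSn; apply: wspan_X.
Qed.

Lemma D_pow_X i : D * X ^+ i = X ^+ i * D + X ^+ i.-1 *+ i.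
Proof.
have := D_ev weylDX 'X^i; rewrite derivXn rmorphMn !rmorphXn /= horner_algX.
by [].
Qed.

Lemma wspan_D k u : wspan k u -> wspan (k + L)%N (act M D u).
Proof.
move=> Wu; apply: (Wu (act M D @^-1` wspan (k + L)%N)).
  exact: subspace_preimage (wspan_subspace _).
move=> i j lt; rewrite /= -actM D_pow_X actD actM -[act M D _]actM -exprS actMn.
apply: (subspD (wspan_subspace _)); first by apply: wspan_gen; lia.
rewrite -scaler_nat; apply: (subspZ (wspan_subspace _)); apply: wspan_gen; lia.
Qed.

(** Giving [D] a weight [L] larger than the degrees of the coefficients of [b]
    makes [X^i0 D^n] the only term of [b] of highest weight. *)
Section Annihilated.
Variables (b : {poly {poly K}}).
Hypotheses (b0 : b != 0) (bv : act M (weyl X D b) v = 0)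
           (bL : forall j, (size (b`_j)%R <= L)%N).

Let n := (size b).-1.
Let i0 := (size b`_n).-1.

Let bn0 : b`_n != 0. Proof. by rewrite -lead_coefE lead_coef_eq0. Qed.

(** The equation [b v = 0], solved for its term of highest weight. *)
Lemma wspan_leading : wspan (i0 + L * n)%N (act M (X ^+ i0) (act M (D ^+ n) v)).
Proof.
have WS := wspan_subspace (i0 + L * n)%N.
have evE p u : act M (ev p) u = \sum_(i < size p) p`_i *: act M (X ^+ i) u.
  by rewrite -{1}[p]coefK act_ev_poly.
have : act M (weyl X D b) v = \sum_(j < n) act M (ev b`_j) (act M (D ^+ j) v)
     + (\sum_(i < i0) b`_n`_i *: act M (X ^+ i) (act M (D ^+ n) v)
     + lead_coef b`_n *: act M (X ^+ i0) (act M (D ^+ n) v)).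
  have -> : weyl X D b = \sum_(j < n.+1) ev b`_j * D ^+ j.
    by rewrite /n prednK // lt0n size_poly_eq0.
  rewrite act_sum big_ord_recr /=; congr (_ + _).
    by apply: eq_bigr => j _; rewrite actM.
  rewrite actM evE lead_coefE -/i0.
  have -> : size b`_n = i0.+1 by rewrite /i0 prednK // lt0n size_poly_eq0.
  by rewrite big_ord_recr.
rewrite bv addrA => /esym /eqP; rewrite addrC addr_eq0 => /eqP E.
rewrite -[act M _ _]scale1r -(mulVf (_ : lead_coef b`_n != 0))
  ?lead_coef_eq0 //.
rewrite -scalerA E; apply: (subspZ WS); apply: (subspN WS); apply: (subspD WS).
  apply: (subsp_sum WS) => j _; rewrite evE; apply: (subsp_sum WS) => i _.
  apply: (subspZ WS); apply: wspan_gen.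
  have := leq_trans (ltn_ord i) (bL j); have := ltn_ord j; nia.
by apply: (subsp_sum WS) => i _; apply: (subspZ WS); apply: wspan_gen;
  rewrite ltn_add2r.
Qed.

(** Multiples of the leading monomial are redundant in their weight; moving
    [D] past [X^i0] costs only terms of lower weight. *)
Lemma wspan_reduce i j : (i0 <= i)%N -> (n <= j)%N ->
  wspan (i + L * j)%N (act M (X ^+ i) (act M (D ^+ j) v)).
Proof.
move=> /subnK <- /subnK <-; set a := (i - i0)%N; set c := (j - n)%N.
rewrite exprD actM -addnA; apply: wspan_XX.
elim: c => [|c IH]; first exact: wspan_leading.
have DXE : act M D (act M (X ^+ i0) (act M (D ^+ (c + n)) v)) =
   act M (X ^+ i0) (act M (D ^+ (c.+1 + n)) v) +
   i0%:R *: act M (X ^+ i0.-1) (act M (D ^+ (c + n)) v).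
  by rewrite -actM D_pow_X actD actM -[act M D _]actM -exprS actMn scaler_nat.
rewrite -[act M (X ^+ i0) _](addrK (i0%:R *: act M (X ^+ i0.-1)
  (act M (D ^+ (c + n)) v))).
rewrite -DXE; apply: (subspB (wspan_subspace _)).
  by apply: wspan_mono (wspan_D IH); rewrite addSn mulnS; lia.
case: (posnP i0) => [->|i0p]; first by rewrite scale0r;
  apply: (subsp0 (wspan_subspace _)).
by apply: (subspZ (wspan_subspace _)); apply: wspan_gen; rewrite addSn mulnS;
  lia.
Qed.

Hypothesis L0 : (0 < L)%N.

(** In each weight only the [n] monomials with [j < n] and the [i0] ones with
    [i < i0] can contribute. *)
Lemma wspan_dim k : dimq_le [set 0] (wspan k) ((n + i0) * k)%N.
Proof.
elim: k => [|k IH]; first by rewrite muln0; apply: dimq_le0 => u Wu;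
  apply: (Wu [set 0]) => //; apply: subspace0.
rewrite mulnS; apply: dimq_le_trans IH.
pose y h := if (h < n)%N then act M (X ^+ (k - L * h)) (act M (D ^+ h) v)
  else act M (X ^+ (h - n)) (act M (D ^+ ((k - (h - n)) %/ L)) v).
exists y => u Wu; apply: (Wu (fun u => exists c : nat -> K,
    wspan k (u - \sum_(i < n + i0) c i *: y i))).
  split; first by exists (fun=> 0); rewrite big1 ?subr0 => [|i _];
    [apply: (subsp0 (wspan_subspace _)) | rewrite scale0r].
  move=> a u1 u2 [c cP] [c' c'P]; exists (fun i => a * c i + c' i).
  have -> : a *: u1 + u2 - \sum_(i < n + i0) (a * c i + c' i) *: y i =
     a *: (u1 - \sum_(i < n + i0) c i *: y i) +
       (u2 - \sum_(i < n + i0) c' i *: y i).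
    rewrite scalerBr addrACA -opprD; congr (_ - _);
      rewrite scaler_sumr -big_split /=.
    by apply: eq_bigr => i _; rewrite scalerDl scalerA.
  exact: (wspan_subspace k).2.
have basis h : (h < n + i0)%N -> exists c : nat ->
  K, wspan k (y h - \sum_(i < n + i0) c i *: y i).
  move=> hl; exists (fun i => (i == h)%:R); rewrite (bigD1 (Ordinal hl)) //=
    eqxx scale1r.
  rewrite big1 ?addr0 ?subrr; first exact: (subsp0 (wspan_subspace _)).
  by move=> i /negPf; rewrite -val_eqE /= => ->; rewrite scale0r.
have trivial u' : wspan k u' -> exists c : nat ->
  K, wspan k (u' - \sum_(i < n + i0) c i *: y i).
  by exists (fun=> 0); rewrite big1 ?subr0 // => i _; rewrite scale0r.
move=> i j; rewrite ltnS leq_eqVlt => /orP [/eqP ijk|lt];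
  last by apply: trivial; apply: wspan_gen.
case: (ltnP j n) => [jn|nj].
  have := basis j (ltn_addr _ jn); rewrite /y jn -ijk addnK; exact.
case: (ltnP i i0) => [ii|ii].
  have := basis (n + i)%N; rewrite ltn_add2l => /(_ ii).
  by rewrite /y ltnNge leq_addr /= addKn -{2}ijk addKn mulKn.
by apply: trivial; rewrite -ijk; apply: wspan_reduce.
Qed.

End Annihilated.
End WeightFiltration.

Section Growth.
Variables (K : fieldType) (A : algType K) (x d s : A).
Hypothesis charK0 : [pchar K] =i pred0.
Hypothesis relA : integro_differential x d s.

Let ds1 : d * s = 1. Proof. by case: relA. Qed.
Let dx : d * x = x * d + 1. Proof. by case: relA. Qed.
Let gen : generates x d s. Proof. by case: relA. Qed.

(** The filtration by weight over the Weyl algebra is not stable under [s];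
    pulling it back along the powers of [d] repairs this because [d^(k+1) s =
    d^k], and the kernel of [d^k] adds at most [k] to the dimension. *)
Lemma simple_growth (M : lmodType A) : simple_module M ->
  exists (G : nat -> set (restr M)) e, linear_growth G e /\
    forall a, exists delta, forall k m, G k m -> G (k + delta)%N (act M a m).
Proof.
move=> Ms; have [[v v0] _] := Ms.
have [b b0 bv] := weyl_annihilator relA Ms v0.
pose L := (\max_(j < size b) size (b`_j)%R).+1.
have bL j : (size (b`_j)%R <= L)%N.
  case: (ltnP j (size b)) => [lt|le]; last by rewrite nth_default ?size_poly0.
  by apply/leqW/(leq_bigmax (F := fun j : 'I_(size b) => size (b`_j)%R)
    (Ordinal lt)).
have Wdim := wspan_dim dx b0 bv bL (ltn0Sn _).
set E := (_ + _)%N in Wdim.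
pose W := wspan x d v L.
have WS k : subspace (W k) by apply: wspan_subspace.
(* The slope 2 * L leaves room for the two derivations needed in [Gd]. *)
pose G k : set (restr M) := act M (d ^+ k) @^-1` W (2 * L * k).+1.
have GS k : subspace (G k) by apply: subspace_preimage.
have WD k u : W k u -> W (k + L)%N (act M d u) by apply: (wspan_D dx).
have WXD k u : W k u -> W (k + L).+1 (act M (x * d) u).
  by move=> Wu; rewrite actM; apply: wspan_X; apply: WD.
have W_mono k l u : (k <= l)%N -> W k u -> W l u by move=> kl;
  apply: wspan_mono.
have G1 k : G k `<=` G k.+1.
  move=> m /WD; rewrite /G /= -actM -exprS; apply: W_mono; lia.
have Gd k m : G k m -> G k.+1 (act M d m).
  by move=> /WD/WD; rewrite /G /= -!actM -exprSr -!mulrA -!exprS;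
    apply: W_mono; lia.
have Gs k m : G k m -> G k.+1 (act M s m).
  by rewrite /G /= -actM exprSr -mulrA ds1 mulr1; apply: W_mono; lia.
have Gx k m : G k m -> G k.+1 (act M x m).
  move=> Gm; rewrite /G /= -actM (dpow_x relA) actD actMn /=.
  apply: (subspD (WS _)).
    by move: (WXD _ _ Gm); rewrite -!actM -mulrA -exprS; apply: W_mono; lia.
  by rewrite -scaler_nat; apply: (subspZ (WS _)); apply: W_mono Gm; lia.
have G_mono k l : (k <= l)%N -> G k `<=` G l.
  by move=> /subnK <-; elim: (l - k)%N => // i IH m /IH; apply: G1.
exists G, (2 * L * E + E + 1)%N; split; first split=> //.
- move=> m; pose S : set (restr M) := fun m => exists k, G k m.
  suff : S m by [].
  apply: (simple_stable relA Ms _ _ v0).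
  + split; first by exists 0%N; apply: (subsp0 (GS _)).
    move=> c u w [k Gu] [l Gw]; exists (maxn k l); apply: (GS _).2.
      by apply: G_mono Gu; rewrite leq_maxl.
    by apply: G_mono Gw; rewrite leq_maxr.
  + by split=> u [k Gu]; exists k.+1; [apply: Gx | apply: Gd | apply: Gs].
  + exists 0%N; rewrite /G /= act1.
    rewrite -[v]act1 -[act M 1 v]act1 -{1}(expr0 x) -(expr0 d);
      apply: wspan_gen; lia.
- move=> k; have := dimq_le_preimage (act M (d ^+ k)) (subspace0 _)
  (Wdim (2 * L * k).+1).
  move/dimq_le_trans => /(_ _ _ (ker_dpow_simple relA k Ms)).
  by apply: dimq_le_mono; nia.
pose P : {pred A} := fun a => `[< exists delta, forall k m, G k m ->
  G (k + delta)%N (act M a m) >].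
move=> a; apply/asboolP; rewrite -[asbool _]/(a \in P).
apply: gen.
- split; first by apply/asboolP; exists 0%N => k m; rewrite addn0 act1.
    move=> c a1 a2 /asboolP [d1 H1] /asboolP [d2 H2]; apply/asboolP.
    exists (maxn d1 d2) => k m Gm; rewrite actD actZ; apply: (GS _).2.
      by apply: G_mono (H1 _ _ Gm); rewrite leq_add2l leq_maxl.
    by apply: G_mono (H2 _ _ Gm); rewrite leq_add2l leq_maxr.
  move=> a1 a2 /asboolP [d1 H1] /asboolP [d2 H2]; apply/asboolP.
  by exists (d2 + d1)%N => k m Gm; rewrite actM addnA; apply: H1; apply: H2.
- by apply/asboolP; exists 1%N => k m; rewrite addn1; apply: Gx.
- by apply/asboolP; exists 1%N => k m; rewrite addn1; apply: Gd.
- by apply/asboolP; exists 1%N => k m; rewrite addn1; apply: Gs.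
Qed.

(** The torsion vectors over [K[d]] form a submodule; when it is everything,
    no vector is left for torsion over [K[x]]. *)
Lemma simple_torsion_dichotomy (M : lmodType A) : simple_module M ->
  torsion_free x M \/ torsion_free d M.
Proof.
move=> Ms.
pose T : set (restr M) := fun m =>
  exists2 p : {poly K}, p != 0 & act M (horner_alg d p) m = 0.
have [[m Tm m0]|none] := pselect (exists2 m, T m & m != 0); last first.
  right=> p m p0 pm; apply: contrapT => /eqP m0; apply: none; exists m => //.
  by exists p.
left; apply: (torsion_free_of_torsion dx charK0) => u.
have Dx : - x * d = d * - x + 1 by rewrite mulrN dx opprD subrK mulNr.
have x_ev p w : act M (horner_alg d p) (act M x w) =
    act M x (act M (horner_alg d p) w) + act M (horner_alg d p^`()) w.
  by have := act_D_ev Dx p w; rewrite !actN linearN /= => /eqP;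
     rewrite eq_sym addrC subr_eq => /eqP ->; rewrite addNKr.
apply: (simple_stable relA Ms _ _ m0 Tm).
  split; first by exists 1; rewrite ?oner_eq0 // linear0.
  move=> k u1 u2 [p p0 pu] [q q0 qu]; exists (p * q);
    first by rewrite mulf_neq0.
  have pq1 : act M (horner_alg d (p * q)) u1 = 0.
    by rewrite mulrC rmorphM actM pu linear0.
  by rewrite linearP /= pq1 scaler0 add0r rmorphM actM qu linear0.
split=> w [p p0 pw].
- exists (p * p); first by rewrite mulf_neq0.
  by rewrite rmorphM actM x_ev pw linear0 add0r ev_comm pw linear0.
- exists p => //; have := ev_comm d p 'X w; rewrite /= horner_algX => ->.
  by rewrite pw linear0.
- exists (p * 'X); first by rewrite mulf_neq0 ?polyX_eq0.
  by rewrite rmorphM /= horner_algX -actM -mulrA ds1 mulr1.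
Qed.

(** Some [d ^+ k * a] is a nonzero Weyl operator, with respect to [(x, d)] as
    well as to the Fourier transformed pair [(d, - x)]; the pair is chosen for
    which the module is torsion free. *)
Lemma simple_fredholm (M : lmodType A) a : simple_module M ->
  ~ span_units d s a -> fredholm_map (act M a).
Proof.
move=> Ms aF; have [G [e [gG GA]]] := simple_growth Ms.
have xd : - x * d = d * - x + 1 by rewrite mulrN dx opprD subrK mulNr.
have ker_a b k X D : D * X = X * D + 1 -> torsion_free X M -> d ^+ k * a =
  weyl X D b ->
    finite_dim (lin_ker (act M a)).
  move=> DX tf bE; have b0 : b != 0.
    apply/eqP => b0; apply: aF; apply: (span_units_of_kill relA (k := k)).
    by rewrite bE b0 weyl0.
  have [delta GX] := GA X.
  have /finite_dimP [n dn] := weyl_ker_finite DX charK0 gG GX tf b0.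
  apply/finite_dimP; exists n; apply: dimq_leS dn => // m;
    rewrite /lin_ker /= => am.
  by rewrite -bE actM am linear0.
have dK : finite_dim (lin_ker (act M a)).
  have [tf|tf] := simple_torsion_dichotomy Ms.
    have [k [b bE]] : exists k, in_weyl x d (d ^+ k * a).
      apply: (normal_form relA) => [|k a1 a2 aW bW|a1|a1];
        first exact: in_weyl1.
      - by apply: in_weylD => //; apply: in_weylZ.
      - exact: in_weylX.
      - exact: in_weyl_D.
    exact: ker_a dx tf bE.
  have [k [b bE]] : exists k, in_weyl d (- x) (d ^+ k * a).
    apply: (normal_form relA) => [|k a1 a2 aW bW|a1 aW|a1];
      first exact: in_weyl1.
    - by apply: in_weylD => //; apply: in_weylZ.
    - have -> : x * a1 = -1 *: (- x * a1) by rewrite scaleN1r mulNr opprK.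
      apply: in_weylZ.
      exact: in_weyl_D.
    - exact: in_weylX.
  exact: ker_a xd tf bE.
split=> //; have /finite_dimP [n dn] := dK; have [delta Ga] := GA a.
by apply/finite_codimP; exists (n + e * delta)%N;
  apply: codim_of_growth gG Ga dn.
Qed.

(** In a finite-dimensional module every vector would be torsion over both
    [K[x]] and [K[d]]. *)
Lemma nonzero_infinite_dim (M : lmodType A) :
  nonzero_module M -> ~ finite_dim (@setT (restr M)).
Proof.
case=> m m0 /finite_dimP [n dn].
have tors X (u : restr M) : exists2 p : {poly K}, p != 0 &
  act M (horner_alg X p) u = 0.
  have : ~ indep_mod [set 0] n.+1 (fun i => act M (X ^+ i) u).
    move=> I; suff: (n.+1 <= n)%N by rewrite ltnn.
    exact: indep_le_dimq (subspace0 _) dn _ I.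
  case/existsNP=> c /not_implyP [c0 /existsNP [i /not_implyP [lt /eqP ci]]].
  exists (\poly_(i < n.+1) c i); last by rewrite act_ev_poly.
  by apply/eqP => /polyP /(_ i) /eqP; rewrite coef_poly lt coef0 (negPf ci).
have [p p0 pm] := tors x m.
have := torsion_free_of_torsion dx charK0 (tors d) p0 pm.
by move/eqP; rewrite (negPf m0).
Qed.

(** For the algebra acting on polynomials this is the module of polynomials,
    presented as [A / A d] and generated by the class [m] of [1]. Every vector
    is killed by a power of [d], and the last nonzero [d^k u] lies in the
    kernel of [d], hence is a nonzero multiple of [m]. *)
Lemma simple_module_exists : exists M : lmodType A, simple_module M.
Proof.
pose N : {pred A^o} := fun a => `[< exists b, a = b * d >].
have NS : submod_closed N.
  split; first by apply/asboolP; exists 0; rewrite mul0r.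
  move=> a u v /asboolP [b ->] /asboolP [c ->]; apply/asboolP.
  by exists (a * b + c); rewrite mulrDl -mulrA.
have [M [f [f_surj fN]]] := quotient_module NS.
pose m : restr M := f 1.
have dm : act M d m = 0.
  rewrite /act /m -linearZ; apply/fN/asboolP; exists 1.
  by rewrite mul1r; exact: mulr1.
have m0 : m != 0.
  apply/eqP => /fN /asboolP [b bd]; case: relA => _ _ _ /eqP + _; apply.
  have -> : s = b by rewrite -[s]mul1r bd -mulrA ds1 mulr1.
  by rewrite -bd.
have mgen (u : restr M) : exists a, u = act M a m.
  have [a <-] := f_surj u; exists a; rewrite /act /m -linearZ.
  by congr (f _); rewrite /GRing.scale /= mulr1.
pose S : set (restr M) := fun u => exists k, act M (d ^+ k) u = 0.
have dX0 k l u : act M (d ^+ k) u = 0 -> act M (d ^+ (l + k)) u = 0.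
  by move=> uk; rewrite exprD actM uk linear0.
have SS : subspace S.
  split; first by exists 0%N; rewrite linear0.
  move=> c u w [k uk] [l wl]; exists (k + l)%N.
  by rewrite linearP /= {1}addnC !dX0 // scaler0 addr0.
have St : stable x d s S.
  split=> u [k uk].
  - exists k.+1; rewrite -actM (dpow_x relA) actD actMn uk mul0rn addr0 actM.
    by rewrite (dX0 k 1%N) // linear0.
  - by exists k; rewrite -actM -exprSr (dX0 k 1%N).
  - by exists k.+1; rewrite -actM exprSr -mulrA ds1 mulr1.
have Sm : S m by exists 1%N.
exists M; split; first by exists m.
move=> P PS; have [[u uP u0]|none] := pselect (exists2 u, u \in P & u != 0);
  last first.
  left=> u; apply/idP/eqP => [uP|->]; last exact: PS.1.
  by apply: contrapT => /eqP u0; apply: none; exists u.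
right=> w; have mulP a (v : M) : v \in P -> act M a v \in P.
  by move=> vP; rewrite /act -[_ *: _]addr0; apply: PS.2 => //; apply: PS.1.
suff mP : (m : M) \in P by have [a ->] := mgen w; rewrite mulP.
have exk : exists k, act M (d ^+ k) u == 0.
  have [a uE] := mgen u; have [k uk] := stable_act relA SS St a Sm.
  by exists k; rewrite uE; apply/eqP.
case: (ex_minnP exk) => -[|k] /eqP uk kmin; first by rewrite act1 in uk;
  rewrite uk eqxx in u0.
have [|c cE] := @ker_d_cyclic _ _ _ _ _ relA M m (act M (d ^+ k) u) mgen dm.
  by rewrite -actM -exprS.
have c0 : c != 0.
  by apply/eqP => c0; have := kmin k; rewrite cE c0 scale0r eqxx ltnn =>
    /(_ isT).
have -> : m = act M (c^-1%:A * d ^+ k) u.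
  by rewrite actM cE -restr_scaleE scalerA mulVf // scale1r.
exact: mulP.
Qed.

End Growth.

(** * The alternative on both sides *)

Section Alternative.
Variables (K : fieldType) (A : algType K) (x d s : A).
Hypothesis charK0 : [pchar K] =i pred0.
Hypothesis relA : integro_differential x d s.

Local Notation F := (span_units d s).

Lemma simple_finite_length (M : lmodType A) : simple_module M ->
  finite_length M.
Proof.
move=> [[m m0] Ms]; pose S i : {pred M} := if i is 0%N then pred1 0 else predT.
exists 1%N, S; split=> // [[|i]|[|//] _].
- by split=> [|a u v]; rewrite !inE // => /eqP -> /eqP ->;
  rewrite scaler0 addr0.
- by split.
split=> // [|P PS _ _]; last exact: Ms.
by move/(_ m isT); rewrite inE (negPf m0).
Qed.

Lemma compact_ideal (M : lmodType A) a : finite_length M -> F a ->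
  compact_map (act M a).
Proof.
move=> Mfl aF; apply: (compact_span_units relA aF).
apply: ker_finite_length Mfl => N Ns; apply/finite_dimP; exists 1%N.
exact: ker_d_simple relA N Ns.
Qed.

Lemma fredholm_off_ideal (M : lmodType A) a :
  finite_length M -> ~ F a -> fredholm_map (act M a).
Proof.
move=> Mfl aF; split.
  by apply: ker_finite_length Mfl => N /(simple_fredholm charK0 relA)
    /(_ aF) [].
by apply: coker_finite_length Mfl => N /(simple_fredholm charK0 relA)
  /(_ aF) [].
Qed.

Section Infinite.
Variables (M : lmodType A) (a : A).
Hypotheses (M0 : nonzero_module M) (aC : compact_map (act M a)).

Lemma compact_infinite_codim : ~ finite_codim (lin_im (act M a)).
Proof.
move=> /finite_codimP [n dn]; move/finite_dimP: aC => [m dm].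
apply: (nonzero_infinite_dim charK0 relA M0).
by apply/finite_dimP; exists (n + m)%N; apply: dimq_le_trans dm.
Qed.

Lemma compact_infinite_ker : ~ finite_dim (lin_ker (act M a)).
Proof.
move=> /finite_dimP [n dn]; move/finite_dimP: aC => [m dm].
apply: (nonzero_infinite_dim charK0 relA M0); apply/finite_dimP;
  exists (m + n)%N.
apply: dimq_le_trans dn;
  apply: dimq_leS (dimq_le_preimage (act M a) (subspace0 _) dm) => //.
by move=> u _; exists u.
Qed.

End Infinite.

Lemma compact_iff_ideal (M : lmodType A) a : nonzero_module M ->
  finite_length M ->
  compact_map (act M a) <-> F a.
Proof.
move=> M0 Mfl; split=> [aC|]; last exact: compact_ideal.
apply: contrapT => /(fredholm_off_ideal Mfl) [_].
exact: compact_infinite_codim.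
Qed.

Lemma finite_length_alternative (a : A) (M : lmodType A) :
  nonzero_module M -> finite_length M ->
  [/\ finite_dim (lin_ker (act M a)) <-> finite_codim (lin_im (act M a)),
      finite_codim (lin_im (act M a)) <-> ~ F a &
      simple_module M -> (finite_dim (lin_im (act M a)) <-> F a)].
Proof.
move=> M0 Mfl; have [aF|aF] := pselect (F a).
  have aC := compact_ideal Mfl aF.
  have nK := compact_infinite_ker M0 aC; have nC :=
    compact_infinite_codim M0 aC.
  by split=> //; split.
have [fK fC] := fredholm_off_ideal Mfl aF.
by split=> // _; apply: compact_iff_ideal.
Qed.

Lemma compact_elements_ideal : compact_elements A = F.
Proof.
rewrite predeqE => a; split=> [aC|aF M Ms]; last first.
  exact: compact_ideal (simple_finite_length Ms) aF.
have [M Ms] := simple_module_exists relA.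
by apply/(compact_iff_ideal a Ms.1 (simple_finite_length Ms)); apply: aC.
Qed.

Lemma fredholm_elements_ideal : fredholm_elements A = ~` F.
Proof.
rewrite predeqE => a; split=> [[+ _]|aF];
  first by rewrite compact_elements_ideal.
split; first by rewrite compact_elements_ideal.
by move=> M Ms; apply: fredholm_off_ideal (simple_finite_length Ms) aF.
Qed.

Lemma strong_alternative : strong_cf_alternative A.
Proof.
split=> [M Ms a|a]; last first.
  by rewrite compact_elements_ideal fredholm_elements_ideal; case:
    (pselect (F a)); [left | right].
have Mfl := simple_finite_length Ms.
have [aF|aF] := pselect (F a); [left; exact: compact_ideal | right].
exact: fredholm_off_ideal.
Qed.

End Alternative.

Section Opposite.
Variables (K : fieldType) (A : algType K) (x d s : A).

Lemma converse_exp (a : A) n : (a : A^c) ^+ n = a ^+ n.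
Proof. by elim: n => // n IH; rewrite exprS IH exprSr. Qed.

(** In the basis [x^n / n!] derivation and integration are transposed shifts
    and [d * x] is diagonal. Transposition therefore exchanges [d] with [s]
    and sends [x = s * (d * x)] to [(d * x) * d]. *)
Lemma integro_differential_converse : integro_differential x d s ->
  @integro_differential K A^c (d * x * d) s d.
Proof.
case=> ds dx sdx sd gen; split.
- exact: ds.
- change (d * x * d * s = s * (d * x * d) + 1).
  by rewrite -!mulrA ds mulr1 !mulrA sdx dx.
- change (d * x * d * (s * d) = d * x * d).
  by rewrite mulrA -[_ * d * s]mulrA ds mulr1.
- exact: sd.
- move=> S [S1 Sl SM] Sx Ss Sd a; apply: gen => //.
    by split=> // b c bS cS; apply: (SM c b).
  have -> : x = s * (d * x * d * s) by rewrite -[_ * d * s]mulrA ds mulr1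
    mulrA sdx.
  exact: (SM _ _ (SM _ _ Ss Sx) Ss).
Qed.

Lemma span_units_converse : @span_units K A^c s d = span_units d s.
Proof.
rewrite predeqE => a; split=> [[n [c ->]]|[n [c ->]]];
  exists n, (fun i j => c j i);
  rewrite exchange_big; apply: eq_bigr => i _; apply: eq_bigr => j _;
    congr (_ *: _);
  rewrite !converse_exp //.
Qed.

End Opposite.

Section Concrete.
Variable K : fieldType.
Hypothesis charK0 : [pchar K] =i pred0.

Lemma I1_integro_differential : integro_differential (x1 K) (d1 K) (int1 K).
Proof.
have n0 n : n.+1%:R != 0 :> K by apply: natr_neq0.
split.
- apply/val_inj/endPolyP => p; apply/polyP => i.
  change ((integ p)^`()`_i = p`_i).
  by rewrite coef_deriv coef_integ -[LHS]mulr_natr divfK.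
- apply/val_inj/endPolyP => p.
  change (('X * p)^`() = 'X * p^`() + p).
  by rewrite derivM derivX mul1r addrC.
- apply/val_inj/endPolyP => p; apply/polyP => i.
  change ((integ ('X * p)^`())`_i = ('X * p)`_i).
  rewrite coef_integ coefXM; case: i => // i.
  by rewrite coef_deriv coefXM /= -[p`_i *+ _]mulr_natr mulfK.
- apply/eqP => /(congr1 (fun f : I1 K =>
    ((val f : endPoly K) : {linear {poly K} -> {poly K}}) 1)) E.
  have {E} : integ (1^`() : {poly K}) = 1 by exact: E.
  by rewrite -polyC1 derivC linear0 => /eqP; rewrite eq_sym polyC_eq0 oner_eq0.
move=> S [S1 Sl SM] Sx Sd Si [f fI].
pose mk g (gI : g \in @inI1 K) : I1 K := exist _ g gI.
pose P : {pred endPoly K} := fun g =>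
  `[< exists gI : g \in @inI1 K, mk g gI \in S >].
have PS (u : I1 K) : u \in S -> val u \in P.
  move=> uS; apply/asboolP; exists (valP u).
  by have -> : mk _ (valP u) = u by apply: val_inj.
have /asboolP [gI] : f \in P; last by rewrite (Prop_irrelevance gI fI).
move/asboolP: (fI); apply; [|exact: PS Sx | exact: PS Sd | exact: PS Si].
split; first exact: (PS 1).
  move=> k g h /asboolP [gI gS] /asboolP [hI hS].
  exact: (PS (k *: mk g gI + mk h hI) (Sl _ _ _ gS hS)).
move=> g h /asboolP [gI gS] /asboolP [hI hS].
exact: (PS (mk g gI * mk h hI) (SM _ _ gS hS)).
Qed.

End Concrete.

Theorem theorem3p1 (K : fieldType) (charK0 : [pchar K] =i pred0) :
  [/\ (* left modules *)
      [/\ strong_cf_alternative (I1 K),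
          compact_elements (I1 K) = idealF K &
          fredholm_elements (I1 K) = ~` idealF K],
      (* right modules *)
      [/\ strong_cf_alternative (I1 K)^c,
          compact_elements (I1 K)^c = idealF K &
          fredholm_elements (I1 K)^c = ~` idealF K],
      (forall (a : I1 K) (M : lmodType (I1 K)),
         nonzero_module M -> finite_length M ->
         [/\ finite_dim (lin_ker (act M a)) <-> finite_codim (lin_im (act M a)),
             finite_codim (lin_im (act M a)) <-> ~ idealF K a &
             simple_module M -> (finite_dim (lin_im (act M a)) <-> idealF K a)]) &
      (forall (a : I1 K) (N : lmodType (I1 K)^c),
         nonzero_module N -> finite_length N ->
         [/\ finite_dim (lin_ker (act N a)) <-> finite_codim (lin_im (act N a)),
             finite_codim (lin_im (act N a)) <-> ~ idealF K a &
             simple_module N -> (finite_dim (lin_im (act N a)) <-> idealF K a)])].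
Proof.
have left := I1_integro_differential charK0.
have right := integro_differential_converse left.
have FE : @span_units K (I1 K)^c (int1 K) (d1 K) = idealF K.
  exact: (span_units_converse (d1 K) (int1 K)).
split.
- split; first exact: strong_alternative left.
    exact: compact_elements_ideal left.
  exact: fredholm_elements_ideal left.
- rewrite -FE; split; first exact: strong_alternative right.
    exact: compact_elements_ideal right.
  exact: fredholm_elements_ideal right.
- exact: finite_length_alternative left.
- by move=> a N; rewrite -FE; apply: finite_length_alternative right a N.
Qed.
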